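(* Let $A$ be a C*-algebra, not assumed to have a unit, such that every maximal abelian self-adjoint subalgebra of $A$ is monotone complete. Then $A$ has a unit and $A$ is an AW*-algebra.
   Context: A C*-algebra $B$ (unital or not) is monotone complete if every norm-bounded, upward directed subset of $B_{sa}$ has a supremum in $B_{sa}$ (for a maximal abelian self-adjoint subalgebra $M$, suprema are taken in $M_{sa}$). A C*-algebra $A$ is an AW*-algebra if (i) each maximal abelian self-adjoint subalgebra of $A$ is norm generated by its projections, and (ii) each family of mutually orthogonal projections in $A$ has a least upper bound in $\mathrm{Proj}(A)$, the set of projections of $A$ with the order inherited from $A_{sa}$. *)

(* Defs.v *)
From Stdlib Require Import Reals.
Open Scope R_scope.

Definition Cx : Type := (R * R)%type.
Definition Cx0 : Cx := (0, 0).
Definition Cx1 : Cx := (1, 0).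
Definition Cxadd (a b : Cx) : Cx := (fst a + fst b, snd a + snd b).
Definition Cxmul (a b : Cx) : Cx :=
  (fst a * fst b - snd a * snd b, fst a * snd b + snd a * fst b).
Definition Cxconj (a : Cx) : Cx := (fst a, - snd a).
Definition Cxabs (a : Cx) : R := sqrt (fst a * fst a + snd a * snd a).

Record CStarAlgebra := {
  car :> Type;
  zero : car;
  add : car -> car -> car;
  opp : car -> car;
  scal : Cx -> car -> car;
  mul : car -> car -> car;
  star : car -> car;
  norm : car -> R;
  add_assoc : forall x y z, add x (add y z) = add (add x y) z;
  add_comm : forall x y, add x y = add y x;
  add_zero : forall x, add x zero = x;
  add_opp : forall x, add x (opp x) = zero;
  scal_addl : forall a b x, scal (Cxadd a b) x = add (scal a x) (scal b x);
  scal_addr : forall a x y, scal a (add x y) = add (scal a x) (scal a y);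
  scal_mul : forall a b x, scal (Cxmul a b) x = scal a (scal b x);
  scal_one : forall x, scal Cx1 x = x;
  mul_assoc : forall x y z, mul x (mul y z) = mul (mul x y) z;
  mul_addl : forall x y z, mul (add x y) z = add (mul x z) (mul y z);
  mul_addr : forall x y z, mul x (add y z) = add (mul x y) (mul x z);
  mul_scall : forall a x y, mul (scal a x) y = scal a (mul x y);
  mul_scalr : forall a x y, mul x (scal a y) = scal a (mul x y);
  star_star : forall x, star (star x) = x;
  star_add : forall x y, star (add x y) = add (star x) (star y);
  star_scal : forall a x, star (scal a x) = scal (Cxconj a) (star x);
  star_mul : forall x y, star (mul x y) = mul (star y) (star x);
  norm_eq0 : forall x, norm x = 0 -> x = zero;
  norm_triangle : forall x y, norm (add x y) <= norm x + norm y;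
  norm_scal : forall a x, norm (scal a x) = Cxabs a * norm x;
  norm_mul : forall x y, norm (mul x y) <= norm x * norm y;
  norm_cstar : forall x, norm (mul (star x) x) = norm x * norm x;
  complete : forall u : nat -> car,
    (forall eps, eps > 0 -> exists N, forall n m, (n >= N)%nat -> (m >= N)%nat ->
        norm (add (u n) (opp (u m))) < eps) ->
    exists l, forall eps, eps > 0 -> exists N, forall n, (n >= N)%nat ->
        norm (add (u n) (opp l)) < eps
}.

Arguments zero {c}.
Arguments add {c}.
Arguments opp {c}.
Arguments scal {c}.
Arguments mul {c}.
Arguments star {c}.
Arguments norm {c}.

Section Notions.
Variable A : CStarAlgebra.

Definition sub (x y : A) : A := add x (opp y).

Definition selfadj (x : A) : Prop := star x = x.

Definition is_proj (p : A) : Prop := mul p p = p /\ star p = p.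

Definition cle (x y : A) : Prop :=
  selfadj x /\ selfadj y /\ exists b : A, sub y x = mul (star b) b.

Definition sa_subalg (S : A -> Prop) : Prop :=
  S zero /\
  (forall x y, S x -> S y -> S (add x y)) /\
  (forall a x, S x -> S (scal a x)) /\
  (forall x y, S x -> S y -> S (mul x y)) /\
  (forall x, S x -> S (star x)).

Definition abelian (S : A -> Prop) : Prop :=
  forall x y, S x -> S y -> mul x y = mul y x.

Definition masa (M : A -> Prop) : Prop :=
  sa_subalg M /\ abelian M /\
  forall N : A -> Prop, sa_subalg N -> abelian N ->
    (forall x, M x -> N x) -> forall x, N x -> M x.

Definition norm_closed (S : A -> Prop) : Prop :=
  forall (u : nat -> A) (l : A), (forall n, S (u n)) ->
    (forall eps, eps > 0 -> exists N, forall n, (n >= N)%nat ->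
        norm (sub (u n) l) < eps) -> S l.

Definition monotone_complete_sub (M : A -> Prop) : Prop :=
  forall D : A -> Prop,
    (forall x, D x -> M x /\ selfadj x) ->
    (exists x, D x) ->
    (forall x y, D x -> D y -> exists z, D z /\ cle x z /\ cle y z) ->
    (exists K, forall x, D x -> norm x <= K) ->
    exists s, M s /\ selfadj s /\ (forall x, D x -> cle x s) /\
      (forall t, M t -> selfadj t -> (forall x, D x -> cle x t) -> cle s t).

Definition proj_generated (M : A -> Prop) : Prop :=
  forall x, M x <->
    (forall N : A -> Prop, sa_subalg N -> norm_closed N ->
       (forall p, M p -> is_proj p -> N p) -> N x).

Definition has_unit : Prop :=
  exists u : A, forall x, mul u x = x /\ mul x u = x.

Definition AWstar : Prop :=
  (forall M, masa M -> proj_generated M) /\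
  (forall (I : Type) (p : I -> A),
     (forall i, is_proj (p i)) ->
     (forall i j, i <> j -> mul (p i) (p j) = zero) ->
     exists e, is_proj e /\ (forall i, cle (p i) e) /\
       (forall f, is_proj f -> (forall i, cle (p i) f) -> cle e f)).

End Notions.

(* Main.v *)
(* In a commutative C*-algebra, an upper bound of all 1 - (1 - r)^2 with 0 <= r <= 2 is
   at least 1 on the whole spectrum, which forces the algebra to be unital. If C is a
   maximal commuting set of selfadjoint elements of the annihilator B of a set P of
   commuting selfadjoint elements, monotone completeness of a masa containing C and P
   provides such an upper bound inside C, and a unit e of C is a unit of B: for x in B the
   element (x - e x)(x - e x)^* commutes with C, hence lies in C, hence is 0. So B has a
   unit. With P empty this is the unit of A; with P an orthogonal family of projections the
   complement of the unit of B is the supremum; with P = {|x| - x} it is the spectral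
   projection of x for the half-line [0, oo), and bisection approximates x by projections.

   Since A is not known to be unital, elements r 1 + a of its unitization are handled as
   left multipliers of A, and x is positive when the multiplier t 1 - x has norm at most t
   for some t > 0; this makes sums of positive elements positive by the triangle
   inequality. *)

Require Import Defs.
From Stdlib Require Import Reals.
From Stdlib Require Import Lra Lia List Classical ClassicalEpsilon.
From mathcomp Require classical_sets.
Import ListNotations.

(** * Deciding identities in a C*-algebra *)

(* Real and purely imaginary scalars are kept apart so that products of scalars do not
   double in size. *)
Inductive coeff := Re (r : R) | Im (r : R) | ReIm (r s : R).

Definition coeff_val (c : coeff) : Cx :=
  match c with Re r => (r, 0) | Im r => (0, r) | ReIm r s => (r, s) end.

Definition coeff_mul (c d : coeff) : coeff :=
  match c, d with
  | Re r, Re s => Re (r * s)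
  | Re r, Im s => Im (r * s)
  | Im r, Re s => Im (r * s)
  | Im r, Im s => Re (- (r * s))
  | Re r, ReIm s t => ReIm (r * s) (r * t)
  | Im r, ReIm s t => ReIm (- (r * t)) (r * s)
  | ReIm s t, Re r => ReIm (s * r) (t * r)
  | ReIm s t, Im r => ReIm (- (t * r)) (s * r)
  | ReIm r s, ReIm t u => ReIm (r * t - s * u) (r * u + s * t)
  end.

Definition coeff_add (c d : coeff) : coeff :=
  match c, d with
  | Re r, Re s => Re (r + s)
  | Re r, Im s => ReIm r s
  | Im r, Re s => ReIm s r
  | Im r, Im s => Im (r + s)
  | Re r, ReIm s t => ReIm (r + s) t
  | Im r, ReIm s t => ReIm s (r + t)
  | ReIm s t, Re r => ReIm (s + r) t
  | ReIm s t, Im r => ReIm s (t + r)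
  | ReIm r s, ReIm t u => ReIm (r + t) (s + u)
  end.

Definition coeff_zero (c : coeff) : Prop :=
  match c with Re r => r = 0 | Im r => r = 0 | ReIm r s => r = 0 /\ s = 0 end.

Lemma coeff_val_mul c d : coeff_val (coeff_mul c d) = Cxmul (coeff_val c) (coeff_val d).
Proof. destruct c, d; unfold Cxmul; simpl; f_equal; ring. Qed.

Lemma coeff_val_add c d : coeff_val (coeff_add c d) = Cxadd (coeff_val c) (coeff_val d).
Proof. destruct c, d; unfold Cxadd; simpl; f_equal; ring. Qed.

Lemma coeff_zero_val c : coeff_zero c -> coeff_val c = Cx0.
Proof. destruct c; simpl; [intros ->|intros ->|intros [-> ->]]; reflexivity. Qed.

Inductive expr :=
| EAtom (n : nat) | EZero | EAdd (e f : expr) | EOpp (e : expr)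
| EScal (c : coeff) (e : expr) | EMul (e f : expr).

(** A first letter and a tail: words are nonempty because an algebra without unit gives no value to
    the empty word. *)
Definition word : Type := (nat * list nat)%type.

Definition ncpoly : Type := list (coeff * word).

Definition word_app (v w : word) : word := (fst v, snd v ++ fst w :: snd w).

Definition poly_scal (c : coeff) (p : ncpoly) : ncpoly :=
  map (fun m => (coeff_mul c (fst m), snd m)) p.

Definition poly_mul (p q : ncpoly) : ncpoly :=
  flat_map (fun m => map (fun k => (coeff_mul (fst m) (fst k), word_app (snd m) (snd k))) q) p.

Fixpoint expand (e : expr) : ncpoly :=
  match e with
  | EAtom n => [(Re 1, (n, []))]
  | EZero => []
  | EAdd e f => expand e ++ expand f
  | EOpp e => poly_scal (Re (-1)) (expand e)
  | EScal c e => poly_scal c (expand e)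
  | EMul e f => poly_mul (expand e) (expand f)
  end.

Definition commuting_in (cs : list (nat * nat)) (i j : nat) : bool :=
  existsb (fun c => (Nat.eqb (fst c) i && Nat.eqb (snd c) j)%bool) cs.

(** The letter [i] moves right past smaller letters known to commute with it and stops at the first
    other letter; pairs in [cs] are looked up with the smaller index first. *)
Fixpoint word_insert (cs : list (nat * nat)) (i n : nat) (l : list nat) : word :=
  if (Nat.ltb n i && commuting_in cs n i)%bool
  then match l with
       | [] => (n, [i])
       | m :: l' => let w := word_insert cs i m l' in (n, fst w :: snd w)
       end
  else (i, n :: l).

Fixpoint word_sort (cs : list (nat * nat)) (n : nat) (l : list nat) : word :=
  match l with
  | [] => (n, [])
  | m :: l' => let w := word_sort cs m l' in word_insert cs n (fst w) (snd w)
  end.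

Fixpoint list_eqb (l k : list nat) : bool :=
  match l, k with
  | [], [] => true
  | i :: l', j :: k' => (Nat.eqb i j && list_eqb l' k')%bool
  | _, _ => false
  end.

Definition word_eqb (v w : word) : bool :=
  (Nat.eqb (fst v) (fst w) && list_eqb (snd v) (snd w))%bool.

Fixpoint mono_insert (c : coeff) (w : word) (p : ncpoly) : ncpoly :=
  match p with
  | [] => [(c, w)]
  | (d, v) :: p' =>
      if word_eqb v w then (coeff_add c d, v) :: p' else (d, v) :: mono_insert c w p'
  end.

Fixpoint collect (cs : list (nat * nat)) (p : ncpoly) : ncpoly :=
  match p with
  | [] => []
  | (c, w) :: p' => mono_insert c (word_sort cs (fst w) (snd w)) (collect cs p')
  end.

Fixpoint coeffs_zero (p : ncpoly) : Prop :=
  match p with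
  | [] => True
  | (c, _) :: p' => coeff_zero c /\ coeffs_zero p'
  end.

Section Reflection.
Variable A : CStarAlgebra.
Implicit Types x y z : A.

Lemma add_zero_l x : add zero x = x.
Proof. now rewrite add_comm, add_zero. Qed.

Lemma add_cancel_l x y z : add x y = add x z -> y = z.
Proof.
  intro H.
  rewrite <- (add_zero_l y), <- (add_zero_l z), <- (add_opp _ x), (add_comm _ x).
  now rewrite <- !add_assoc, H.
Qed.

Lemma scal_zero a : scal a zero = zero :> A.
Proof. apply (add_cancel_l (scal a zero)). now rewrite <- scal_addr, !add_zero. Qed.

Lemma scal_Cx0 x : scal Cx0 x = zero.
Proof.
  apply (add_cancel_l (scal Cx0 x)). rewrite <- scal_addl, add_zero.
  f_equal. unfold Cxadd, Cx0; simpl; f_equal; ring.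
Qed.

Lemma mul_zero_l x : mul zero x = zero.
Proof. apply (add_cancel_l (mul zero x)). now rewrite <- mul_addl, !add_zero. Qed.

Lemma mul_zero_r x : mul x zero = zero.
Proof. apply (add_cancel_l (mul x zero)). now rewrite <- mul_addr, !add_zero. Qed.

Lemma opp_scal x : opp x = scal (-1, 0) x.
Proof.
  apply (add_cancel_l x). rewrite add_opp, <- (scal_one _ x) at 1.
  rewrite <- scal_addl, <- (scal_Cx0 x). f_equal.
  unfold Cxadd, Cx0, Cx1; simpl; f_equal; ring.
Qed.

Lemma sub_eq0 x y : sub A x y = zero -> x = y.
Proof.
  intro H. apply (add_cancel_l (opp y)).
  now rewrite (add_comm _ (opp y) x), (add_comm _ (opp y) y), add_opp.
Qed.

Variable env : nat -> A.

Fixpoint eval (e : expr) : A :=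
  match e with
  | EAtom n => env n
  | EZero => zero
  | EAdd e f => add (eval e) (eval f)
  | EOpp e => opp (eval e)
  | EScal c e => scal (coeff_val c) (eval e)
  | EMul e f => mul (eval e) (eval f)
  end.

Fixpoint eval_word (n : nat) (l : list nat) : A :=
  match l with
  | [] => env n
  | m :: l' => mul (env n) (eval_word m l')
  end.

Fixpoint eval_poly (p : ncpoly) : A :=
  match p with
  | [] => zero
  | (c, w) :: p' => add (scal (coeff_val c) (eval_word (fst w) (snd w))) (eval_poly p')
  end.

Fixpoint pairs_commute (cs : list (nat * nat)) : Prop :=
  match cs with
  | [] => True
  | (i, j) :: cs' => mul (env i) (env j) = mul (env j) (env i) /\ pairs_commute cs'
  end.

Lemma eval_app p q : eval_poly (p ++ q) = add (eval_poly p) (eval_poly q).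
Proof.
  induction p as [|[c w] p IH]; simpl; [now rewrite add_zero_l|].
  rewrite IH. apply add_assoc.
Qed.

Lemma eval_poly_scal c p : eval_poly (poly_scal c p) = scal (coeff_val c) (eval_poly p).
Proof.
  induction p as [|[d w] p IH]; simpl; [now rewrite scal_zero|].
  now rewrite IH, scal_addr, coeff_val_mul, scal_mul.
Qed.

Lemma eval_word_app n l m k :
  eval_word n (l ++ m :: k) = mul (eval_word n l) (eval_word m k).
Proof.
  revert n; induction l as [|i l IH]; intro n; simpl; [reflexivity|].
  now rewrite IH, mul_assoc.
Qed.

Lemma eval_poly_mul p q : eval_poly (poly_mul p q) = mul (eval_poly p) (eval_poly q).
Proof.
  induction p as [|[c w] p IH]; simpl; [now rewrite mul_zero_l|].
  unfold poly_mul in *; simpl. rewrite eval_app, IH, mul_addl. f_equal.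
  clear IH. induction q as [|[d v] q IH]; simpl; [now rewrite mul_zero_r|].
  now rewrite IH, mul_addr, eval_word_app, !mul_scall, mul_scalr, coeff_val_mul, scal_mul.
Qed.

Lemma eval_expand e : eval_poly (expand e) = eval e.
Proof.
  induction e; simpl.
  - now rewrite add_zero, scal_one.
  - reflexivity.
  - now rewrite eval_app, IHe1, IHe2.
  - now rewrite eval_poly_scal, IHe, <- opp_scal.
  - now rewrite eval_poly_scal, IHe.
  - now rewrite eval_poly_mul, IHe1, IHe2.
Qed.

Lemma commuting_in_sound cs i j :
  pairs_commute cs -> commuting_in cs i j = true ->
  mul (env i) (env j) = mul (env j) (env i).
Proof.
  unfold commuting_in. induction cs as [|[a b] cs IH]; simpl; [discriminate|].
  intros [H1 H2] H. apply Bool.orb_prop in H as [H|H]; [|now apply IH].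
  apply andb_prop in H as [Ha Hb].
  apply Nat.eqb_eq in Ha, Hb. now subst.
Qed.

Lemma eval_word_insert cs i n l : pairs_commute cs ->
  eval_word (fst (word_insert cs i n l)) (snd (word_insert cs i n l))
  = mul (env i) (eval_word n l).
Proof.
  intro Hcs. revert n; induction l as [|m l IH]; intro n; simpl;
    destruct (_ && _)%bool eqn:E; simpl; try reflexivity;
    apply andb_prop in E as [_ E]; apply commuting_in_sound in E; auto.
  now rewrite IH, !mul_assoc, E.
Qed.

Lemma eval_word_sort cs n l : pairs_commute cs ->
  eval_word (fst (word_sort cs n l)) (snd (word_sort cs n l)) = eval_word n l.
Proof.
  intro Hcs. revert n; induction l as [|m l IH]; intro n; simpl; [reflexivity|].
  now rewrite eval_word_insert, IH.
Qed.

Lemma list_eqb_eq l k : list_eqb l k = true -> l = k.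
Proof.
  revert k; induction l as [|i l IH]; intros [|j k]; simpl; try easy.
  intro H. apply andb_prop in H as [H1 H2]. apply Nat.eqb_eq in H1.
  now rewrite H1, (IH k H2).
Qed.

Lemma eval_mono_insert c w p :
  eval_poly (mono_insert c w p)
  = add (scal (coeff_val c) (eval_word (fst w) (snd w))) (eval_poly p).
Proof.
  induction p as [|[d v] p IH]; simpl; [reflexivity|].
  destruct (word_eqb v w) eqn:E; simpl.
  - apply andb_prop in E as [E1 E2]. apply Nat.eqb_eq in E1. apply list_eqb_eq in E2.
    rewrite <- E1, <- E2, coeff_val_add, scal_addl. now rewrite add_assoc.
  - rewrite IH, !add_assoc. f_equal. apply add_comm.
Qed.

Lemma eval_collect cs p : pairs_commute cs -> eval_poly (collect cs p) = eval_poly p.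
Proof.
  intro Hcs. induction p as [|[c w] p IH]; simpl; [reflexivity|].
  now rewrite eval_mono_insert, IH, eval_word_sort.
Qed.

Lemma coeffs_zero_eval p : coeffs_zero p -> eval_poly p = zero.
Proof.
  induction p as [|[c w] p IH]; simpl; [reflexivity|].
  intros [Hc H]. now rewrite (IH H), (coeff_zero_val c Hc), scal_Cx0, add_zero.
Qed.

Lemma alg_sound cs e f : pairs_commute cs ->
  coeffs_zero (collect cs (expand (EAdd e (EOpp f)))) -> eval e = eval f.
Proof.
  intros Hcs H. apply sub_eq0. apply coeffs_zero_eval in H.
  now rewrite eval_collect, eval_expand in H.
Qed.

End Reflection.

(** * Reification of goals and collection of commutation hypotheses *)

Ltac in_list x l :=
  match l with
  | nil => constr:(false)
  | x :: _ => constr:(true)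
  | _ :: ?l' => in_list x l'
  end.

Ltac index_of x l :=
  match l with
  | x :: _ => constr:(O)
  | _ :: ?l' => let n := index_of x l' in constr:(S n)
  end.

Ltac atoms l e :=
  match e with
  | zero => l
  | add ?a ?b => let l := atoms l a in atoms l b
  | sub _ ?a ?b => let l := atoms l a in atoms l b
  | mul ?a ?b => let l := atoms l a in atoms l b
  | opp ?a => atoms l a
  | scal _ ?a => atoms l a
  | _ => match in_list e l with
         | true => l
         | false => constr:(e :: l)
         end
  end.

Ltac reify l e :=
  match e with
  | zero => constr:(EZero)
  | add ?a ?b => let a := reify l a in let b := reify l b in constr:(EAdd a b)
  | sub _ ?a ?b => let a := reify l a in let b := reify l b in constr:(EAdd a (EOpp b))
  | mul ?a ?b => let a := reify l a in let b := reify l b in constr:(EMul a b)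
  | opp ?a => let a := reify l a in constr:(EOpp a)
  | scal (?r, IZR Z0) ?a => let a := reify l a in constr:(EScal (Re r) a)
  | scal (IZR Z0, ?r) ?a => let a := reify l a in constr:(EScal (Im r) a)
  | scal (?r, ?s) ?a => let a := reify l a in constr:(EScal (ReIm r s) a)
  | _ => let n := index_of e l in constr:(EAtom n)
  end.

Ltac commute_pairs_with x n l k cs :=
  match l with
  | nil => cs
  | ?y :: ?l' =>
      let cs := match goal with
                | _ : mul x y = mul y x |- _ => constr:((n, k) :: cs)
                | _ : mul y x = mul x y |- _ => constr:((n, k) :: cs)
                | _ => cs
                end in
      commute_pairs_with x n l' (S k) cs
  end.

Ltac commute_pairs l n :=
  match l with
  | nil => constr:(@nil (nat * nat))
  | ?x :: ?l' =>
      let cs := commute_pairs l' (S n) in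
      commute_pairs_with x n l' (S n) cs
  end.

(* Commutation hypotheses [mul x y = mul y x] between atoms are taken from the context. *)
Ltac alg :=
  match goal with
  | |- @eq (car ?A) ?a ?b =>
      let l := atoms (@nil (car A)) a in
      let l := atoms l b in
      let ea := reify l a in
      let eb := reify l b in
      let cs := commute_pairs l O in
      let cs := eval cbv in cs in
      change (eval A (fun n => nth n l zero) ea = eval A (fun n => nth n l zero) eb);
      apply (alg_sound A (fun n => nth n l zero) cs);
      [ cbn [pairs_commute nth]; repeat split; first [assumption | symmetry; assumption]
      | cbv [coeffs_zero collect expand poly_scal poly_mul word_app mono_insert word_sort
             word_insert commuting_in word_eqb list_eqb existsb Nat.eqb Nat.ltb Nat.leb
             andb orb map flat_map app fst snd coeff_mul coeff_add coeff_zero];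
        repeat split; first [ring | field; lra] ]
  end.

(** * Norms and limits *)

Notation rscal r x := (scal (r%R, 0%R) x).

Section Norm.
Variable A : CStarAlgebra.
Implicit Types x y z : A.

Lemma star_zero : star zero = zero :> A.
Proof. apply (add_cancel_l A (star zero)). now rewrite <- star_add, !add_zero. Qed.

Lemma star_rscal r x : star (rscal r x) = rscal r (star x).
Proof. rewrite star_scal. unfold Cxconj; simpl. now rewrite Ropp_0. Qed.

Lemma star_scal_i r x : star (scal (0, r) x) = scal (0, - r) (star x).
Proof. apply star_scal. Qed.

Lemma star_opp x : star (opp x) = opp (star x).
Proof. now rewrite !opp_scal, star_rscal. Qed.

Lemma star_sub x y : star (sub A x y) = sub A (star x) (star y).
Proof. unfold sub. now rewrite star_add, star_opp. Qed.

Lemma norm_zero : norm (zero : A) = 0.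
Proof.
  rewrite <- (scal_Cx0 A zero), norm_scal. unfold Cxabs, Cx0; simpl.
  rewrite Rmult_0_l, Rplus_0_l, sqrt_0. ring.
Qed.

Lemma norm_rscal r x : norm (rscal r x) = Rabs r * norm x.
Proof.
  rewrite norm_scal. unfold Cxabs; simpl. f_equal.
  replace (r * r + 0 * 0) with (Rsqr r) by (unfold Rsqr; ring). apply sqrt_Rsqr_abs.
Qed.

Lemma norm_scal_i x : norm (scal (0, 1) x) = norm x.
Proof.
  rewrite norm_scal. unfold Cxabs; simpl.
  replace (0 * 0 + 1 * 1) with 1 by ring. rewrite sqrt_1. ring.
Qed.

Lemma norm_opp x : norm (opp x) = norm x.
Proof. rewrite opp_scal, norm_rscal, Rabs_left; lra. Qed.

Lemma norm_ge0 x : 0 <= norm x.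
Proof.
  pose proof (norm_triangle A x (opp x)) as H.
  rewrite norm_opp, add_opp, norm_zero in H. lra.
Qed.

Lemma norm_le_add x y z a b :
  norm y <= a -> norm z <= b -> x = add y z -> norm x <= a + b.
Proof. intros Hy Hz ->. pose proof (norm_triangle A y z). lra. Qed.

Lemma norm_sub_le x y : norm (sub A x y) <= norm x + norm y.
Proof. unfold sub. rewrite <- (norm_opp y). apply norm_triangle. Qed.

Lemma norm_sub_sym x y : norm (sub A x y) = norm (sub A y x).
Proof. rewrite <- norm_opp. f_equal. alg. Qed.

Lemma norm_sub0 x y : norm (sub A x y) <= 0 -> x = y.
Proof.
  intro H. apply sub_eq0, norm_eq0. pose proof (norm_ge0 (sub A x y)). lra.
Qed.

(** The C*-identity gives [norm x * norm x <= norm (star x) * norm x]; cancel [norm x]. *)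
Lemma norm_le_star x : norm x <= norm (star x).
Proof.
  pose proof (norm_ge0 x) as Hx. pose proof (norm_ge0 (star x)).
  destruct (Req_dec (norm x) 0) as [->|Hn]; [lra|].
  pose proof (norm_mul A (star x) x) as H1. rewrite norm_cstar in H1. nra.
Qed.

Lemma norm_star x : norm (star x) = norm x.
Proof.
  apply Rle_antisym; [|apply norm_le_star].
  pose proof (norm_le_star (star x)) as H. now rewrite star_star in H.
Qed.

Lemma norm_mul_star x : norm (mul x (star x)) = norm x * norm x.
Proof.
  rewrite <- (norm_star x), <- norm_cstar. now rewrite star_star.
Qed.

Lemma norm_sq x : selfadj A x -> norm (mul x x) = norm x * norm x.
Proof. intro H. rewrite <- norm_cstar. now rewrite H. Qed.

Lemma star_mul_eq0 x : mul (star x) x = zero -> x = zero.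
Proof.
  intro H. apply norm_eq0. pose proof (norm_cstar A x) as H1.
  rewrite H, norm_zero in H1. nra.
Qed.

Lemma sq_eq0 x : selfadj A x -> mul x x = zero -> x = zero.
Proof. intros H H0. apply star_mul_eq0. now rewrite H. Qed.

(* Testing [y = star a] recovers the norm of [a] from that of left multiplication by [a]. *)

Lemma norm_le_of_mul a k : 0 <= k ->
  (forall y, norm (mul a y) <= k * norm y) -> norm a <= k.
Proof.
  intros Hk H. specialize (H (star a)). rewrite norm_mul_star, norm_star in H.
  pose proof (norm_ge0 a). nra.
Qed.

(** Phrased through [Un_cv] so that the arithmetic of real limits applies to the norms. *)
Definition lim (u : nat -> A) (l : A) : Prop :=
  Un_cv (fun n => norm (sub A (u n) l)) 0.

Lemma lim_iff u l : lim u l <->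
  forall eps, eps > 0 -> exists N, forall n, (n >= N)%nat -> norm (sub A (u n) l) < eps.
Proof.
  split; intros H eps He; destruct (H eps He) as [N HN]; exists N; intros n Hn;
    specialize (HN n Hn); unfold Rdist in *; rewrite Rminus_0_r, Rabs_pos_eq in *;
    auto using norm_ge0.
Qed.

Lemma lim_squeeze u l f :
  (forall n, norm (sub A (u n) l) <= f n) -> Un_cv f 0 -> lim u l.
Proof.
  intros Hf H eps He. destruct (H eps He) as [N HN]. exists N; intros n Hn.
  specialize (HN n Hn). specialize (Hf n). pose proof (norm_ge0 (sub A (u n) l)).
  unfold Rdist in *. rewrite Rminus_0_r, Rabs_pos_eq in * by lra. lra.
Qed.

Lemma Un_cv_const c : Un_cv (fun _ => c) c.
Proof. intros eps He. exists O. intros. unfold Rdist. rewrite Rminus_diag, Rabs_R0. lra. Qed.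

Lemma lim_const x : lim (fun _ => x) x.
Proof.
  apply lim_squeeze with (fun _ => 0); [|apply Un_cv_const].
  intro n. replace (sub A x x) with (zero : A) by alg. rewrite norm_zero. lra.
Qed.

Lemma lim_shift u l : lim u l -> lim (fun n => u (S n)) l.
Proof.
  intros H eps He. destruct (H eps He) as [N HN]. exists N. intros n Hn.
  apply HN. lia.
Qed.

Lemma lim_ext u v l : (forall n, u n = v n) -> lim u l -> lim v l.
Proof.
  intros E H eps He. destruct (H eps He) as [N HN]. exists N. intros n Hn.
  rewrite <- E. now apply HN.
Qed.

Lemma lim_add u v l m : lim u l -> lim v m -> lim (fun n => add (u n) (v n)) (add l m).
Proof.
  intros Hu Hv.
  apply lim_squeeze with (fun n => norm (sub A (u n) l) + norm (sub A (v n) m));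
    [|rewrite <- (Rplus_0_r 0); now apply CV_plus].
  intro n. cbv beta. eapply norm_le_add; [apply Rle_refl..|alg].
Qed.

Lemma lim_mul u v l m : lim u l -> lim v m -> lim (fun n => mul (u n) (v n)) (mul l m).
Proof.
  intros Hu Hv.
  apply lim_squeeze with (fun n => norm (sub A (u n) l) * norm (sub A (v n) m)
    + (norm (sub A (u n) l) * norm m + norm l * norm (sub A (v n) m))).
  - intro n.
    apply norm_le_add with (mul (sub A (u n) l) (sub A (v n) m))
      (add (mul (sub A (u n) l) m) (mul l (sub A (v n) m))); [apply norm_mul| |alg].
    eapply norm_le_add; [apply norm_mul..|reflexivity].
  - replace 0 with (0 * 0 + (0 * norm m + norm l * 0)) by ring.
    repeat apply CV_plus; apply CV_mult; auto using Un_cv_const.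
Qed.

Lemma lim_rscal_seq s u r l : Un_cv s r -> lim u l ->
  lim (fun n => rscal (s n) (u n)) (rscal r l).
Proof.
  intros Hs Hu.
  apply lim_squeeze with (fun n => Rabs (s n) * norm (sub A (u n) l)
    + Rabs (s n - r) * norm l).
  - intro n.
    apply norm_le_add with (rscal (s n) (sub A (u n) l)) (rscal (s n - r) l);
      [rewrite norm_rscal; lra..|alg].
  - replace 0 with (Rabs r * 0 + 0 * norm l) by ring.
    apply CV_plus; apply CV_mult; auto using Un_cv_const.
    + now apply cv_cvabs.
    + intros eps He. destruct (Hs eps He) as [N HN]. exists N. intros n Hn.
      unfold Rdist. rewrite Rminus_0_r, Rabs_Rabsolu. now apply HN.
Qed.

Lemma lim_rscal r u l : lim u l -> lim (fun n => rscal r (u n)) (rscal r l).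
Proof. apply lim_rscal_seq, Un_cv_const. Qed.

Lemma lim_sub u v l m : lim u l -> lim v m -> lim (fun n => sub A (u n) (v n)) (sub A l m).
Proof.
  intros Hu Hv. unfold sub. rewrite opp_scal.
  apply lim_ext with (fun n => add (u n) (rscal (-1) (v n))).
  - intro n. now rewrite opp_scal.
  - apply lim_add; [exact Hu|now apply lim_rscal].
Qed.

Lemma lim_star u l : lim u l -> lim (fun n => star (u n)) (star l).
Proof.
  apply lim_squeeze. intro n. rewrite <- star_sub, norm_star. lra.
Qed.

Lemma lim_unique u l m : lim u l -> lim u m -> l = m.
Proof.
  intros Hl Hm. apply norm_sub0.
  apply (Rle_cv_lim (Un := fun _ => norm (sub A l m))
    (Vn := fun n => norm (sub A (u n) l) + norm (sub A (u n) m))).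
  - intro n. rewrite (norm_sub_sym (u n) l).
    eapply norm_le_add; [apply Rle_refl..|alg].
  - apply Un_cv_const.
  - rewrite <- (Rplus_0_r 0). now apply CV_plus.
Qed.

Lemma lim_norm_le u l k : lim u l -> (forall n, norm (u n) <= k) -> norm l <= k.
Proof.
  intros Hl Hk.
  apply (Rle_cv_lim (Un := fun _ => norm l) (Vn := fun n => norm (sub A (u n) l) + k)).
  - intro n. rewrite norm_sub_sym.
    apply norm_le_add with (sub A l (u n)) (u n); [lra|apply Hk|alg].
  - apply Un_cv_const.
  - pose proof (CV_plus _ _ _ _ Hl (Un_cv_const k)) as H. now rewrite Rplus_0_l in H.
Qed.

Lemma lim_commute u l c : (forall n, mul c (u n) = mul (u n) c) -> lim u l ->
  mul c l = mul l c.
Proof.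
  intros E H. eapply lim_unique.
  - apply lim_mul; [apply (lim_const c)|apply H].
  - eapply lim_ext; [intro n; symmetry; apply E|].
    apply lim_mul; [apply H|apply lim_const].
Qed.

Lemma lim_selfadj u l : (forall n, selfadj A (u n)) -> lim u l -> selfadj A l.
Proof.
  intros E H. apply lim_unique with u; [|exact H].
  eapply lim_ext; [apply E|]. now apply lim_star.
Qed.

(** The increments of [u] are dominated by those of [s], which is increasing and bounded, hence
    Cauchy. *)
Lemma lim_of_variation u (s : nat -> R) k :
  (forall n, norm (sub A (u (S n)) (u n)) <= s (S n) - s n) ->
  (forall n, s n <= k) -> exists l, lim u l.
Proof.
  intros Hu Hk.
  assert (Hs : forall n m, (n <= m)%nat -> norm (sub A (u m) (u n)) <= s m - s n).
  { intros n m H. induction H as [|m H IH].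
    - replace (sub A (u n) (u n)) with (zero : A) by alg. rewrite norm_zero. lra.
    - replace (s (S m) - s n) with ((s (S m) - s m) + (s m - s n)) by ring.
      eapply norm_le_add; [apply Hu|apply IH|alg]. }
  assert (Hg : Un_growing s).
  { intro n. specialize (Hu n). pose proof (norm_ge0 (sub A (u (S n)) (u n))). lra. }
  destruct (growing_cv s Hg) as [r Hr].
  { exists k. intros x [n ->]. apply Hk. }
  apply (fun H => CV_Cauchy s (exist _ r H)) in Hr.
  destruct (complete A u) as [l Hl].
  - intros eps He. destruct (Hr eps He) as [N HN]. exists N. intros n m Hn Hm.
    assert (H : forall n m, (n >= N)%nat -> (m >= N)%nat -> (n <= m)%nat ->
      norm (sub A (u m) (u n)) < eps).
    { intros i j Hi Hj Hij. eapply Rle_lt_trans; [now apply Hs|].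
      eapply Rle_lt_trans; [apply Rle_abs|]. now apply HN. }
    destruct (Nat.le_ge_cases n m).
    + change (norm (sub A (u n) (u m)) < eps). rewrite norm_sub_sym. now apply H.
    + now apply H.
  - exists l. now apply lim_iff.
Qed.

End Norm.

Arguments lim {A}.

Ltac star_norm :=
  unfold selfadj in *;
  repeat first [ rewrite star_add | rewrite star_sub | rewrite star_mul
               | rewrite star_rscal | rewrite star_scal_i | rewrite star_opp | rewrite star_star
               | rewrite star_zero ];
  repeat match goal with
         | H : star ?x = ?x |- context [star ?x] => rewrite H
         end.

Ltac sa := star_norm; alg.

Lemma sub_of_eq (A : CStarAlgebra) (x y : A) : x = y -> sub A x y = zero.
Proof. intros ->. apply add_opp. Qed.

(* Proves [X = Y] modulo [H : L = R], given [f] with [X - Y = f (L - R)]. *)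
Ltac alg_mod f H :=
  match goal with
  | |- ?X = ?Y =>
      match type of H with
      | ?L = ?R =>
          transitivity (add Y (f (sub _ L R)));
          [ cbv beta; alg | rewrite (sub_of_eq _ _ _ H); cbv beta; alg ]
      end
  end.

(** * Square roots *)

Section SquareRoot.
Variable A : CStarAlgebra.
Implicit Types x y z : A.

(* The element [r 1 + a] of the unitization has norm at most [k] as a left multiplier. *)
Definition mbound (r : R) (a : A) (k : R) : Prop :=
  forall y, norm (add (rscal r y) (mul a y)) <= k * norm y.

Lemma mbound_norm a : mbound 0 a (norm a).
Proof.
  intro y. replace (add (rscal 0 y) (mul a y)) with (mul a y) by alg. apply norm_mul.
Qed.

Lemma norm_le_mbound r a k : 0 <= k -> mbound r a k -> norm a <= k + Rabs r.
Proof.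
  intros Hk H. apply norm_le_of_mul; [pose proof (Rabs_pos r); lra|]. intro y.
  rewrite Rmult_plus_distr_r.
  apply norm_le_add with (add (rscal r y) (mul a y)) (rscal (- r) y); [apply H| |alg].
  rewrite norm_rscal, Rabs_Ropp. lra.
Qed.

Lemma mbound_ext r a k r' a' k' :
  mbound r' a' k' -> r = r' -> a = a' -> k' <= k -> mbound r a k.
Proof.
  intros H -> -> Hk y. specialize (H y). pose proof (norm_ge0 A y). nra.
Qed.

Lemma mbound_add r a k s b l :
  mbound r a k -> mbound s b l -> mbound (r + s) (add a b) (k + l).
Proof.
  intros Ha Hb y. rewrite Rmult_plus_distr_r.
  eapply norm_le_add; [apply Ha|apply Hb|alg].
Qed.

Lemma mbound_rscal c r a k : 0 <= c -> mbound r a k -> mbound (c * r) (rscal c a) (c * k).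
Proof.
  intros Hc Ha y. specialize (Ha y).
  replace (add (rscal (c * r) y) (mul (rscal c a) y))
    with (rscal c (add (rscal r y) (mul a y))) by alg.
  rewrite norm_rscal, Rabs_pos_eq by lra. nra.
Qed.

(** Composition of multipliers, expanded as [(r 1 + a)(s 1 + b) = r s 1 + (a b + r b + s a)]. *)
Lemma mbound_mul r a k s b l : 0 <= k ->
  mbound r a k -> mbound s b l ->
  mbound (r * s) (add (mul a b) (add (rscal r b) (rscal s a))) (k * l).
Proof.
  intros Hk Ha Hb y. specialize (Ha (add (rscal s y) (mul b y))). specialize (Hb y).
  match goal with |- norm ?x <= _ => match type of Ha with norm ?z <= _ =>
    replace x with z by alg end end.
  nra.
Qed.

Lemma mbound_lim s u r a k :
  Un_cv s r -> lim u a -> (forall n, mbound (s n) (u n) k) -> mbound r a k.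
Proof.
  intros Hs Hu H y. eapply lim_norm_le; [|intro n; apply (H n y)].
  apply lim_add; [apply lim_rscal_seq|apply lim_mul]; auto using lim_const.
Qed.

(* Visser's iteration [s := (z + s^2) / 2], started at [0], converges to [s] with
   [(1 - s)^2 = 1 - z]; it is run on [z = l 1 + b] of norm at most [1], and dominated by
   its instance [z = 1]. *)
Fixpoint visser_scalar (l : R) (n : nat) : R :=
  match n with
  | O => 0
  | S n => (l + visser_scalar l n * visser_scalar l n) / 2
  end.

(** The algebra part of the iterate for [l 1 + b]; its scalar part is [visser_scalar l n], whence
    the cross term of the square. *)
Fixpoint visser (l : R) (b : A) (n : nat) : A :=
  match n with
  | O => zero
  | S n => rscal (/ 2) (add b (add (rscal (2 * visser_scalar l n) (visser l b n))
                                   (mul (visser l b n) (visser l b n))))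
  end.

Lemma visser_scalar_bound l n : 0 <= l <= 1 ->
  0 <= visser_scalar l n <= visser_scalar 1 n /\ visser_scalar 1 n <= 1.
Proof. intro Hl. induction n as [|n IH]; simpl; [lra|]. nra. Qed.

(** Each new increment is half the previous increment times the sum of the last two iterates, and
    both factors are dominated by those for [l = 1]. *)
Lemma visser_scalar_step l n : 0 <= l <= 1 ->
  0 <= visser_scalar l (S n) - visser_scalar l n
    <= visser_scalar 1 (S n) - visser_scalar 1 n.
Proof.
  intro Hl. induction n as [|n IH]; [simpl; lra|].
  pose proof (visser_scalar_bound l n Hl) as H1.
  pose proof (visser_scalar_bound l (S n) Hl) as H2.
  set (s := visser_scalar l) in *. set (t := visser_scalar 1) in *.
  change (s (S (S n))) with ((l + s (S n) * s (S n)) / 2).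
  change (t (S (S n))) with ((1 + t (S n) * t (S n)) / 2).
  assert (Es : s (S n) = (l + s n * s n) / 2) by reflexivity.
  assert (Et : t (S n) = (1 + t n * t n) / 2) by reflexivity.
  assert ((s (S n) - s n) * (s (S n) + s n) <= (t (S n) - t n) * (t (S n) + t n))
    by (apply Rmult_le_compat; lra).
  nra.
Qed.

Lemma visser_scalar_lim l : 0 <= l <= 1 ->
  exists s, Un_cv (visser_scalar l) s /\ 0 <= s <= 1 /\ 2 * s - s * s = l.
Proof.
  intro Hl.
  assert (Hg : Un_growing (visser_scalar l)).
  { intro n. pose proof (visser_scalar_step l n Hl). lra. }
  destruct (growing_cv _ Hg) as [s Hs].
  { exists 1. intros x [n ->]. pose proof (visser_scalar_bound l n Hl). lra. }
  exists s. split; [exact Hs|]. split.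
  - split.
    + eapply Rle_cv_lim; [|apply Un_cv_const|exact Hs].
      intro n. pose proof (visser_scalar_bound l n Hl). lra.
    + eapply Rle_cv_lim; [|exact Hs|apply Un_cv_const].
      intro n. pose proof (visser_scalar_bound l n Hl). lra.
  - assert (E : s = (l + s * s) / 2); [|lra].
    apply UL_sequence with (fun n => visser_scalar l (S n)).
    + intros eps He. destruct (Hs eps He) as [N HN]. exists N. intros. apply HN. lia.
    + cbn [visser_scalar]. unfold Rdiv.
      apply (CV_mult (fun n => l + visser_scalar l n * visser_scalar l n) (fun _ => / 2));
        [|apply Un_cv_const].
      apply (CV_plus (fun _ => l)); [apply Un_cv_const|]. now apply CV_mult.
Qed.

Section Visser.
Variables (l : R) (b : A).
Hypothesis Hl : 0 <= l <= 1.
Hypothesis Hb : mbound l b 1.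

Lemma visser_commute c n :
  mul c b = mul b c -> mul c (visser l b n) = mul (visser l b n) c.
Proof.
  intro H. induction n as [|n IH]; simpl; [alg|].
  set (a := visser l b n) in *. alg.
Qed.

Lemma visser_selfadj n : selfadj A b -> selfadj A (visser l b n).
Proof.
  intro H. induction n as [|n IH]; simpl; [apply star_zero|].
  set (a := visser l b n) in *. sa.
Qed.

Lemma visser_bound n : mbound (visser_scalar l n) (visser l b n) (visser_scalar 1 n).
Proof.
  induction n as [|n IH].
  - intro y. simpl. replace (add (rscal 0 y) (mul zero y)) with (zero : A) by alg.
    rewrite norm_zero. lra.
  - pose proof (visser_scalar_bound l n Hl).
    eapply mbound_ext.
    + apply (mbound_rscal (/ 2)); [lra|].
      apply mbound_add; [apply Hb|]. apply mbound_mul; [|apply IH|apply IH]. lra.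
    + simpl. lra.
    + simpl. set (a := visser l b n). alg.
    + simpl. lra.
Qed.

(** The factorization of increments used for the scalars holds in the unitization too, because the
    iterates commute. *)
Lemma visser_step n :
  mbound (visser_scalar l (S n) - visser_scalar l n)
    (sub A (visser l b (S n)) (visser l b n))
    (visser_scalar 1 (S n) - visser_scalar 1 n).
Proof.
  induction n as [|n IH].
  - eapply mbound_ext; [apply (mbound_rscal (/ 2)); [lra|apply Hb]|simpl; field| |simpl; lra].
    simpl. alg.
  - pose proof (visser_scalar_bound l n Hl).
    pose proof (visser_scalar_bound l (S n) Hl).
    assert (Hc : mul (visser l b n) (visser l b (S n)) = mul (visser l b (S n)) (visser l b n)).
    { apply visser_commute. symmetry. now apply visser_commute. }
    eapply mbound_ext.
    + apply (mbound_rscal (/ 2)); [lra|].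
      apply mbound_mul;
        [|apply mbound_add; [apply (visser_bound (S n))|apply (visser_bound n)]|apply IH]. lra.
    + cbn [visser_scalar]. field.
    + change (visser l b (S (S n)))
        with (rscal (/ 2) (add b (add (rscal (2 * visser_scalar l (S n)) (visser l b (S n)))
                                   (mul (visser l b (S n)) (visser l b (S n)))))).
      assert (E : visser l b (S n)
        = rscal (/ 2) (add b (add (rscal (2 * visser_scalar l n) (visser l b n))
                                   (mul (visser l b n) (visser l b n))))) by reflexivity.
      set (a := visser l b (S n)) in *. set (a' := visser l b n) in *.
      set (s := visser_scalar l (S n)). set (s' := visser_scalar l n) in *.
      alg_mod (fun z : A => opp z) E.
    + cbn [visser_scalar]. apply Req_le. field.
Qed.

(** The limit [s 1 + a] satisfies [(1 - s - a)^2 = 1 - l - b]; the two displayed equations are its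
    scalar part and its algebra part. *)
Lemma visser_root : selfadj A b -> exists s a,
  0 <= s <= 1 /\ 2 * s - s * s = l /\
  selfadj A a /\ mbound s a 1 /\
  sub A (rscal (2 - 2 * s) a) (mul a a) = b /\
  (forall c, mul c b = mul b c -> mul c a = mul a c).
Proof.
  intro Hsa. destruct (visser_scalar_lim l Hl) as [s [Hs [Hs1 Hs2]]].
  (* The norm of the algebra part is at most the multiplier bound plus the scalar part; each is at
     most the increment for [l = 1], hence the factor 2. *)
  destruct (lim_of_variation A (visser l b) (fun n => 2 * visser_scalar 1 n) 2) as [a Ha].
  - intro n. pose proof (visser_step n) as H.
    pose proof (visser_scalar_step l n Hl).
    apply norm_le_mbound in H; [|lra]. rewrite Rabs_pos_eq in H by lra. lra.
  - intro n. pose proof (visser_scalar_bound l n Hl). lra.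
  - exists s, a. repeat split; try tauto.
    + eapply lim_selfadj; [|apply Ha]. intro n. now apply visser_selfadj.
    + eapply mbound_lim; [apply Hs|apply Ha|]. intro n.
      pose proof (visser_scalar_bound l n Hl).
      eapply mbound_ext; [apply visser_bound|reflexivity..|lra].
    + assert (E : a = rscal (/ 2) (add b (add (rscal (2 * s) a) (mul a a)))).
      { eapply lim_unique; [apply lim_shift, Ha|]. cbn [visser].
        apply lim_rscal, lim_add; [apply lim_const|].
        apply lim_add; [|now apply lim_mul].
        apply lim_rscal_seq; [|exact Ha]. apply (CV_mult (fun _ => 2)); [apply Un_cv_const|exact Hs]. }
      alg_mod (fun z : A => rscal 2 z) E.
    + intros c Hc. eapply lim_commute; [|apply Ha]. intro n. now apply visser_commute.
Qed.

End Visser.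

Definition is_pos x : Prop := selfadj A x /\ exists t, 0 < t /\ mbound t (opp x) t.

(** For [l = 1] and [b = - x / t] the root has [s = 1] and [a^2 = x / t]. The bound on [1 + a] makes
    [h = - sqrt t a] the positive choice of sign. *)
Lemma pos_sqrt x : is_pos x -> exists h, is_pos h /\ mul h h = x /\
  forall c, mul c x = mul x c -> mul c h = mul h c.
Proof.
  intros [Hsa [t [Ht Hx]]].
  destruct (visser_root 1 (rscal (/ t) (opp x))) as [s [a [Hs [Hs2 [Ha [Hb [E Hc]]]]]]].
  - lra.
  - eapply mbound_ext; [apply (mbound_rscal (/ t)); [|apply Hx]|field; lra|reflexivity|].
    + left. now apply Rinv_0_lt_compat.
    + right. field. lra.
  - sa.
  - assert (s = 1) as -> by nra.
    assert (Hr : sqrt t * sqrt t = t) by (apply sqrt_sqrt; lra).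
    pose proof (sqrt_lt_R0 t Ht) as Hr0.
    exists (rscal (- sqrt t) a). split; [split; [sa|]|split].
    + exists (sqrt t). split; [exact Hr0|].
      eapply mbound_ext; [apply (mbound_rscal (sqrt t)); [lra|apply Hb]|ring|alg|lra].
    + transitivity (rscal (sqrt t * sqrt t) (mul a a)); [alg|]. rewrite Hr.
      alg_mod (fun z : A => rscal (- t) z) E.
    + intros c H. assert (H1 : mul c a = mul a c); [|alg]. apply Hc. alg.
Qed.

(* For [t] with [(1 - t)^2 = 1 - q^2] the elements [1 - t + i q] and [1 - t - i q] of the
   unitization are mutually inverse unitaries. *)
Lemma cosine_isometry q t e y : selfadj A q -> selfadj A t -> mul q t = mul t q ->
  sub A (rscal 2 t) (mul t t) = mul q q -> e = 1 \/ e = -1 ->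
  norm (add (sub A y (mul t y)) (scal (0, e) (mul q y))) = norm y.
Proof.
  intros Hq Ht Hc E He.
  set (u := add (sub A y (mul t y)) (scal (0, e) (mul q y))).
  assert (H : norm u * norm u = norm y * norm y).
  { rewrite <- !norm_cstar. f_equal. unfold u. star_norm.
    destruct He as [-> | ->]; alg_mod (fun z => opp (mul (star y) (mul z y))) E. }
  pose proof (norm_ge0 A u). pose proof (norm_ge0 A y). nra.
Qed.

(** Writing [q = sin w] and [1 - t = cos w], the last three bounds concern [cos w], [sin (2 w)] and
    [cos (2 w)]. They come from averaging the isometries [exp (i w)] and [exp (- i w)], or their
    squares. *)
Lemma cosine q : selfadj A q -> norm q <= 1 -> exists t,
  selfadj A t /\ norm t <= 1 /\ sub A (rscal 2 t) (mul t t) = mul q q /\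
  (forall c, mul c q = mul q c -> mul c t = mul t c) /\
  mbound 1 (opp t) 1 /\
  mbound 0 (rscal 2 (sub A q (mul t q))) 1 /\
  mbound 1 (rscal (-2) (mul q q)) 1.
Proof.
  intros Hq Hn.
  destruct (visser_root 0 (mul q q)) as [s [t [Hs [Hs2 [Ht [Hb [E Hc]]]]]]].
  - lra.
  - eapply mbound_ext; [apply mbound_norm|reflexivity..|].
    rewrite norm_sq by exact Hq. pose proof (norm_ge0 A q). nra.
  - sa.
  - assert (s = 0) as -> by nra.
    assert (Hcq : mul q t = mul t q) by (apply Hc; alg).
    assert (E' : sub A (rscal 2 t) (mul t t) = mul q q) by (rewrite <- E; alg).
    assert (Hu : forall e y, e = 1 \/ e = -1 ->
      norm (rscal (/ 2) (add (sub A y (mul t y)) (scal (0, e) (mul q y)))) <= norm y / 2).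
    { intros e y He. rewrite norm_rscal, (cosine_isometry q t) by assumption.
      rewrite Rabs_pos_eq; lra. }
    set (u e y := add (sub A y (mul t y)) (scal (0, e) (mul q y))) in Hu.
    assert (Hu2 : forall e y, e = 1 \/ e = -1 ->
      norm (rscal (/ 2) (u e (u e y))) <= norm y / 2).
    { intros e y He. eapply Rle_trans; [apply Hu, He|]. unfold u.
      rewrite (cosine_isometry q t) by assumption. lra. }
    exists t. repeat split; try assumption.
    + apply norm_le_mbound in Hb; [|lra]. rewrite Rabs_R0 in Hb. lra.
    + intros c H. apply Hc. alg.
    + intro y. replace (1 * norm y) with (norm y / 2 + norm y / 2) by field.
      eapply norm_le_add; [apply (Hu 1)|apply (Hu (-1))|]; try tauto. unfold u. alg.
    + intro y. rewrite <- norm_scal_i.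
      replace (1 * norm y) with (norm y / 2 + norm y / 2) by field.
      eapply norm_le_add with (z := opp _); [apply (Hu2 1)|rewrite norm_opp; apply (Hu2 (-1))|];
        try tauto. unfold u. alg.
    + intro y. replace (1 * norm y) with (norm y / 2 + norm y / 2) by field.
      eapply norm_le_add; [apply (Hu2 1)|apply (Hu2 (-1))|]; try tauto. unfold u.
      alg_mod (fun z => mul z y) E'.
Qed.

End SquareRoot.

Arguments mbound {A}.
Arguments is_pos {A}.

(** * Positivity *)

Section Positivity.
Variable A : CStarAlgebra.
Implicit Types a b c d x y z : A.

Lemma pos_add x y : is_pos x -> is_pos y -> is_pos (add x y).
Proof.
  intros [Hx [s [Hs Bx]]] [Hy [t [Ht By]]]. split; [sa|].
  exists (s + t). split; [lra|].
  eapply mbound_ext; [apply mbound_add; [apply Bx|apply By]|reflexivity|alg|lra].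
Qed.

Lemma pos_rscal r x : 0 < r -> is_pos x -> is_pos (rscal r x).
Proof.
  intros Hr [Hx [t [Ht Bx]]]. split; [sa|].
  exists (r * t). split; [nra|].
  eapply mbound_ext; [apply (mbound_rscal A r); [lra|apply Bx]|reflexivity|alg|lra].
Qed.

(** With [q = x / sqrt t], the multiplier [t 1 - x^2] is the mean of [t 1] and [t (1 - 2 q^2)], and
    the latter is a multiple of a cosine. *)
Lemma sq_mbound x t : selfadj A x -> 0 < t -> norm (mul x x) <= t ->
  mbound t (opp (mul x x)) t.
Proof.
  intros Hx Ht Hn. rewrite norm_sq in Hn by exact Hx.
  assert (Hr : sqrt t * sqrt t = t) by (apply sqrt_sqrt; lra).
  pose proof (sqrt_lt_R0 t Ht) as Hr0.
  destruct (cosine A (rscal (/ sqrt t) x)) as [_ [_ [_ [_ [_ [_ [_ H]]]]]]].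
  - sa.
  - rewrite norm_rscal, Rabs_pos_eq by (left; now apply Rinv_0_lt_compat).
    apply Rmult_le_reg_l with (sqrt t); [exact Hr0|].
    rewrite <- Rmult_assoc, Rinv_r, Rmult_1_l, Rmult_1_r by lra.
    pose proof (norm_ge0 A x). apply Rsqr_incr_0_var; unfold Rsqr; lra.
  - intro y. specialize (H y).
    assert (E : rscal (/ t) (mul x x)
      = mul (rscal (/ sqrt t) x) (rscal (/ sqrt t) x)).
    { rewrite <- Hr at 1. rewrite Rinv_mult. alg. }
    rewrite <- E, Rmult_1_l in H.
    replace (t * norm y) with (t / 2 * norm y + t / 2 * norm y) by field.
    eapply norm_le_add with (y := rscal (t / 2) y) (z := rscal (t / 2) _).
    + rewrite norm_rscal, Rabs_pos_eq; lra.
    + rewrite norm_rscal, Rabs_pos_eq by lra. apply Rmult_le_compat_l; [lra|apply H].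
    + alg.
Qed.

Lemma pos_sq x : selfadj A x -> is_pos (mul x x).
Proof.
  intro Hx. split; [sa|]. exists (norm (mul x x) + 1).
  pose proof (norm_ge0 A (mul x x)). split; [lra|]. apply sq_mbound; lra || assumption.
Qed.

(* If [x = a^2] and [- x = b^2] with [a], [b] commuting, then [a + i b] is normal with
   square modulus [0]. *)
Lemma pos_antisym x : is_pos x -> is_pos (opp x) -> x = zero.
Proof.
  intros Hx Hnx.
  destruct (pos_sqrt A _ Hx) as [a [[Ha _] [Ea Ca]]].
  destruct (pos_sqrt A _ Hnx) as [b [[Hb _] [Eb Cb]]].
  assert (Hax : mul a x = mul x a) by (rewrite <- Ea; alg).
  assert (Hab : mul a b = mul b a) by (apply Cb; alg).
  assert (Hw : add a (scal (0, 1) b) = zero).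
  { apply star_mul_eq0. transitivity (add (mul a a) (mul b b)); [sa|].
    rewrite Ea, Eb. apply add_opp. }
  assert (E : a = zero).
  { transitivity (rscal (/ 2) (add (add a (scal (0, 1) b)) (star (add a (scal (0, 1) b)))));
      [sa|]. rewrite Hw, star_zero. alg. }
  rewrite <- Ea, E. alg.
Qed.

(** * Positivity of the elements [star b b] *)

Lemma geometric_le_linear r k :
  (forall n, r ^ n <= 1 + INR n * k) -> 0 <= k -> r <= 1.
Proof.
  intros H Hk. apply Rnot_lt_le. intro Hr.
  set (d := r - 1). assert (Hd : 0 < d) by (unfold d; lra).
  destruct (INR_unbounded (2 * k / (d * d))) as [n Hn].
  (* Bernoulli's inequality; squared, it makes [r ^ (n + n)] grow quadratically against the linear
     bound. *)
  assert (H1 : 1 + INR n * d <= r ^ n).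
  { replace r with (1 + d) by (unfold d; ring). now apply poly. }
  specialize (H (n + n)%nat). rewrite pow_add, plus_INR in H.
  pose proof (pos_INR n).
  assert (H2 : (1 + INR n * d) * (1 + INR n * d) <= r ^ n * r ^ n)
    by (apply Rmult_le_compat; nra).
  assert (H3 : 2 * k < INR n * (d * d)).
  { replace (2 * k) with (2 * k / (d * d) * (d * d)) by (field; lra).
    apply Rmult_lt_compat_r; [nra|exact Hn]. }
  assert (0 < INR n) by nra.
  nra.
Qed.

(* For selfadjoint [h] the sequence [norm ((1 + h)^n y)] is logarithmically convex, so it
   either never grows or grows geometrically. *)
Lemma mbound_of_linear_growth h k : selfadj A h -> 0 <= k ->
  (forall n y, norm (Nat.iter n (fun z => add z (mul h z)) y) <= (1 + INR n * k) * norm y) ->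
  mbound 1 h 1.
Proof.
  intros Hh Hk H y. set (f n := Nat.iter n (fun z => add z (mul h z)) y).
  replace (add (rscal 1 y) (mul h y)) with (f 1%nat) by (unfold f; simpl; alg).
  (* One selfadjoint factor [1 + h] is moved across the star, from the left [f (S n)] to the right
     one. *)
  assert (Hconv : forall n, norm (f (S n)) * norm (f (S n)) <= norm (f n) * norm (f (S (S n)))).
  { intro n. rewrite <- norm_cstar, <- (norm_star A (f n)).
    replace (mul (star (f (S n))) (f (S n))) with (mul (star (f n)) (f (S (S n))));
      [apply norm_mul|].
    change (f (S (S n))) with (add (f (S n)) (mul h (f (S n)))).
    change (f (S n)) with (add (f n) (mul h (f n))). set (w := f n). sa. }
  rewrite Rmult_1_l. apply Rnot_lt_le. intro Hlt.
  change y with (f 0%nat) in Hlt.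
  pose proof (norm_ge0 A (f 0%nat)) as H0.
  assert (Hp : 0 < norm (f 0%nat)).
  { assert (H1 : norm (f 1%nat) <= (1 + INR 1 * k) * norm (f 0%nat)) by exact (H 1%nat y).
    simpl INR in H1. nra. }
  set (r := norm (f 1%nat) / norm (f 0%nat)).
  assert (Hr : norm (f 1%nat) = r * norm (f 0%nat)) by (unfold r; field; lra).
  assert (Hr1 : 1 < r) by nra.
  assert (Hstep : forall n, 0 < norm (f n) /\ r * norm (f n) <= norm (f (S n))).
  { induction n as [|n [IH1 IH2]]; [lra|]. specialize (Hconv n).
    assert (0 < norm (f (S n))) by nra. split; [assumption|].
    apply Rmult_le_reg_l with (norm (f n)); [assumption|]. nra. }
  assert (Hgeo : forall n, r ^ n * norm (f 0%nat) <= norm (f n)).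
  { induction n as [|n IH]; [simpl; lra|]. destruct (Hstep n) as [_ H2].
    eapply Rle_trans; [|exact H2]. rewrite <- tech_pow_Rmult, Rmult_assoc.
    apply Rmult_le_compat_l; lra. }
  assert (r <= 1); [|lra]. apply (geometric_le_linear r k); [|exact Hk].
  intro n. apply Rmult_le_reg_r with (norm (f 0%nat)); [exact Hp|].
  eapply Rle_trans; [apply Hgeo|]. apply (H n y).
Qed.

(* With [k = c c^*] and [h = d^2] one has [(1 - k / t)^n c = c (1 + h / t)^n], where the
   left side stays bounded. *)
Lemma star_mul_neg_sq (c d : A) : is_pos (mul c (star c)) -> selfadj A d ->
  mul (star c) c = opp (mul d d) -> d = zero.
Proof.
  intros [_ [t [Ht Bk]]] Hd E. apply sq_eq0; [exact Hd|].
  (* What is left is that the multiplier [t 1 + d^2] has norm at most [t]. *)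
  apply pos_antisym; [now apply pos_sq|]. split; [sa|]. exists t. split; [exact Ht|].
  set (h := rscal (/ t) (mul d d)).
  assert (Ec : mul (star c) c = rscal (- t) h).
  { rewrite E. unfold h. alg. }
  assert (Hh : mbound 1 h 1).
  { assert (Hit : 0 < / t) by now apply Rinv_0_lt_compat.
    apply mbound_of_linear_growth with (/ t * (norm c * norm c)).
    - unfold h. sa.
    - pose proof (norm_ge0 A c). assert (0 <= norm c * norm c) by nra. nra.
    - intros n y.
      assert (Hbd : forall m,
        norm (mul c (Nat.iter m (fun z => add z (mul h z)) y)) <= norm c * norm y).
      { induction m as [|m IH]; [apply norm_mul|].
        cbn [Nat.iter nat_rect]. set (z := Nat.iter m _ y) in *.
        change (norm (mul c (add z (mul h z))) <= norm c * norm y).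
        apply Rle_trans with (norm (mul c z)); [|exact IH].
        specialize (Bk (mul c z)).
        apply Rmult_le_reg_l with t; [exact Ht|].
        rewrite <- (Rabs_pos_eq t) at 1 by lra. rewrite <- norm_rscal.
        match type of Bk with norm ?u <= _ =>
          replace (rscal t (mul c (add z (mul h z)))) with u; [exact Bk|] end.
        alg_mod (fun w : A => opp (mul (mul c w) z)) Ec. }
      (* Since [h z = - star c (c z) / t], the bound [Hbd] on [c z] limits the growth at each step
         to a fixed amount. *)
      induction n as [|n IH]; [simpl; lra|].
      rewrite S_INR.
      replace ((1 + (INR n + 1) * (/ t * (norm c * norm c))) * norm y)
        with ((1 + INR n * (/ t * (norm c * norm c))) * norm y
              + / t * (norm c * (norm c * norm y))) by ring.
      cbn [Nat.iter nat_rect] in *. specialize (Hbd n). set (z := Nat.iter n _ y) in *.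
      change (norm (add z (mul h z)) <=
       (1 + INR n * (/ t * (norm c * norm c))) * norm y
       + / t * (norm c * (norm c * norm y))).
      apply norm_le_add with z (rscal (- / t) (mul (star c) (mul c z))); [exact IH| |].
      + rewrite norm_rscal, Rabs_Ropp, Rabs_pos_eq by lra.
        apply Rmult_le_compat_l; [lra|].
        eapply Rle_trans; [apply norm_mul|]. rewrite norm_star.
        apply Rmult_le_compat_l; [apply norm_ge0|exact Hbd].
      + alg_mod (fun w : A => rscal (/ t) (mul w z)) Ec. }
  eapply mbound_ext; [apply (mbound_rscal A t); [lra|apply Hh]|ring| |lra].
  unfold h. alg.
Qed.

(* Fukamiya, Kelley-Vaught: with [h = |x|] for [x = b^* b], the element [c = b (h - x)]
   has [c^* c] equal to minus a square. *)
Lemma pos_star_mul (b : A) : is_pos (mul (star b) b).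
Proof.
  set (x := mul (star b) b).
  assert (Hx : selfadj A x) by (unfold x; sa).
  destruct (pos_sqrt A _ (pos_sq x Hx)) as [h [Hh [Eh Ch]]].
  destruct (pos_sqrt A _ Hh) as [g [[Hg _] [Eg Cg]]].
  assert (Hsh : selfadj A h) by apply Hh.
  assert (Hxh : mul x h = mul h x) by (apply Ch; alg).
  assert (Hxg : mul x g = mul g x) by (now apply Cg).
  assert (Hhg : mul h g = mul g h) by (apply Cg; alg).
  set (n := sub A h x).
  assert (Hsn : selfadj A n) by (unfold n; sa).
  assert (Hgn : mul g n = mul n g) by (unfold n; alg).
  assert (Enx : mul n x = opp (mul n h)).
  { unfold n. alg_mod (fun z : A => z) Eh. }
  assert (Hd : mul g n = zero).
  { apply star_mul_neg_sq with (c := mul b n).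
    - set (c := mul b n).
      assert (Ecc : mul (star c) c = opp (mul (mul g n) (mul g n))).
      { transitivity (mul n (mul x n)); [unfold c, x; sa|].
        transitivity (mul (mul n x) n); [alg|]. rewrite Enx, <- Eg. alg. }
      (* For the real and imaginary parts of [c], the sum of [c (star c)] and [(star c) c] is
         [2 (c1^2 + c2^2)]; as [(star c) c] is minus a square, [c (star c)] is a sum of positive
         elements. *)
      set (c1 := rscal (/ 2) (add c (star c))).
      set (c2 := scal (0, / 2) (sub A (star c) c)).
      replace (mul c (star c)) with
        (add (rscal 2 (add (mul c1 c1) (mul c2 c2))) (mul (mul g n) (mul g n))).
      + apply pos_add; [apply pos_rscal; [lra|apply pos_add]|]; apply pos_sq;
          unfold c1, c2; sa.
      + unfold c1, c2. alg_mod (fun z : A => z) Ecc.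
    - sa.
    - transitivity (mul n (mul x n)); [unfold x; sa|].
      transitivity (mul (mul n x) n); [alg|]. rewrite Enx, <- Eg. alg. }
  assert (Enh : mul n h = zero).
  { rewrite <- Eg. transitivity (mul (mul g n) g); [alg|]. rewrite Hd. alg. }
  assert (En : n = zero).
  { apply sq_eq0; [exact Hsn|]. unfold n at 2.
    transitivity (sub A (mul n h) (mul n x)); [alg|]. rewrite Enx, Enh. alg. }
  apply sub_eq0 in En. now rewrite <- En.
Qed.

Lemma cle_pos x y : cle A x y -> is_pos (sub A y x).
Proof. intros [_ [_ [b ->]]]. apply pos_star_mul. Qed.

Lemma cle_of_sq x y g : selfadj A x -> selfadj A y -> selfadj A g ->
  sub A y x = mul g g -> cle A x y.
Proof. intros Hx Hy Hg E. repeat split; try assumption. exists g. now rewrite Hg. Qed.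

(** The factor [b] in [cle] need not commute with anything; the root [g] commutes with all that
    commutes with the difference. *)
Lemma cle_sqrt x y : cle A x y -> exists g, selfadj A g /\ sub A y x = mul g g /\
  forall c, mul c (sub A y x) = mul (sub A y x) c -> mul c g = mul g c.
Proof.
  intro H. destruct (pos_sqrt A _ (cle_pos x y H)) as [g [[Hg _] [E C]]].
  now exists g.
Qed.

End Positivity.

(** * Maximal abelian subalgebras *)

Section Commutant.
Variable A : CStarAlgebra.
Implicit Types a b c m p x y z : A.
Implicit Types S C M : A -> Prop.

Lemma maximal_commuting (Q S : A -> Prop) :
  (forall x, S x -> Q x) -> abelian A S ->
  exists C, (forall x, S x -> C x) /\ (forall x, C x -> Q x) /\ abelian A C /\
    forall x, Q x -> (forall c, C c -> mul x c = mul c x) -> C x.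
Proof.
  intros HQ HS.
  (* The sets are asked to commute with [S] instead of containing it, so that the union of the empty
     chain qualifies; [S] is adjoined afterwards. *)
  destruct (@classical_sets.Zorn_bigcup A (fun X : A -> Prop =>
    (forall x, X x -> Q x) /\ abelian A X /\
    (forall x s, X x -> S s -> mul x s = mul s x))) as [X [[HX1 [HX2 HX3]] Hmax]].
  - intros F HF Htot. split; [|split].
    + intros x [X HX Hx]. destruct (HF X HX) as [Hq _]. now apply Hq.
    + intros x y [X HX Hx] [Y HY Hy].
      destruct (Htot X Y HX HY) as [H|H].
      * destruct (HF Y HY) as [_ [Hc _]]. apply Hc; [apply H, Hx|exact Hy].
      * destruct (HF X HX) as [_ [Hc _]]. apply Hc; [exact Hx|apply H, Hy].
    + intros x s [X HX Hx]. destruct (HF X HX) as [_ [_ Hc]]. now apply Hc.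
  - exists (fun x => X x \/ S x). split; [now right|]. split; [|split].
    + intros x [H|H]; auto.
    + intros x y [Hx|Hx] [Hy|Hy]; auto. symmetry. auto.
    + intros x Hx Hc. left. apply NNPP. intro Hn.
      apply (Hmax (fun y => X y \/ y = x)).
      * split; [now left|]. intro H. apply Hn, H. now right.
      * split; [|split].
        -- intros y [H| ->]; auto.
        -- intros y z [Hy| ->] [Hz| ->]; auto. symmetry. auto.
        -- intros y s [Hy| ->] Hs; auto.
Qed.

Lemma re_im x : exists a b, selfadj A a /\ selfadj A b /\ x = add a (scal (0, 1) b) /\
  forall c, mul c x = mul x c -> mul c (star x) = mul (star x) c ->
    mul c a = mul a c /\ mul c b = mul b c.
Proof.
  exists (rscal (/ 2) (add x (star x))), (scal (0, / 2) (sub A (star x) x)).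
  repeat split; [sa|sa|alg|alg|alg].
Qed.

Lemma commutant_subalg S : (forall x, S x -> S (star x)) ->
  sa_subalg A (fun x => forall s, S s -> mul s x = mul x s).
Proof.
  intro HS. repeat split.
  - intros s _. alg.
  - intros x y Hx Hy s Hs. specialize (Hx s Hs). specialize (Hy s Hs). alg.
  - intros [r i] x Hx s Hs. specialize (Hx s Hs). alg.
  - intros x y Hx Hy s Hs. specialize (Hx s Hs). specialize (Hy s Hs). alg.
  - intros x Hx s Hs. specialize (Hx (star s) (HS s Hs)).
    apply (f_equal star) in Hx. rewrite !star_mul, !star_star in Hx. now symmetry.
Qed.

(** The masa is the commutant of a maximal commuting selfadjoint set [C] containing [S]: real parts
    of its elements lie in [C] by maximality, as do imaginary parts, so it is abelian. *)
Lemma masa_containing S : (forall x, S x -> selfadj A x) -> abelian A S ->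
  exists M, masa A M /\ forall x, S x -> M x.
Proof.
  intros HS Hab.
  destruct (maximal_commuting (selfadj A) S HS Hab) as [C [HSC [HC [HCab Hmax]]]].
  exists (fun x => forall c, C c -> mul c x = mul x c).
  split; [|intros x Hx c Hc; apply HCab; auto].
  assert (Hstar : forall x, C x -> C (star x)) by (intros x Hx; now rewrite HC).
  pose proof (commutant_subalg C Hstar) as Hsub.
  split; [exact Hsub|]. split.
  - intros x y Hx Hy.
    destruct (re_im x) as [a [b [Ha [Hb [-> Hc]]]]].
    assert (Hxs : forall c, C c -> mul c (star (add a (scal (0, 1) b)))
      = mul (star (add a (scal (0, 1) b))) c) by exact (proj2 (proj2 (proj2 (proj2 Hsub))) _ Hx).
    assert (Ca : C a) by (apply Hmax; [exact Ha|intros c H; symmetry; now apply Hc; auto]).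
    assert (Cb : C b) by (apply Hmax; [exact Hb|intros c H; symmetry; now apply Hc; auto]).
    pose proof (Hy a Ca). pose proof (Hy b Cb). alg.
  - intros N HN HNab HMN x Hx c Hc. apply HNab; [|exact Hx].
    apply HMN. intros d Hd. now apply HCab.
Qed.

Section Masa.
Variable M : A -> Prop.
Hypothesis HM : masa A M.

(** The double commutant of [M] with [y] adjoined is an abelian selfadjoint subalgebra containing
    [M], so maximality applies to it. *)
Lemma masa_mem y : selfadj A y -> (forall m, M m -> mul m y = mul y m) -> M y.
Proof.
  intros Hy Hc. destruct HM as [[_ [_ [_ [_ Hst]]]] [Hab Hmax]].
  set (S := fun x => M x \/ x = y).
  assert (HS : forall x, S x -> S (star x)).
  { intros x [H| ->]; [left; auto|right; exact Hy]. }
  assert (HSab : abelian A S).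
  { intros u v [Hu| ->] [Hv| ->]; auto. symmetry. auto. }
  set (S' := fun x => forall s, S s -> mul s x = mul x s).
  assert (HS' : forall x, S' x -> S' (star x)) by exact (proj2 (proj2 (proj2 (proj2 (commutant_subalg S HS))))).
  assert (HSS' : forall x, S x -> S' x) by (intros x Hx s Hs; now apply HSab).
  apply (Hmax (fun x => forall s, S' s -> mul s x = mul x s)).
  - now apply commutant_subalg.
  - intros u v Hu Hv. apply Hv. intros s Hs. apply Hu. now apply HSS'.
  - intros x Hx s Hs. symmetry. apply Hs. now left.
  - intros s Hs. symmetry. apply Hs. now right.
Qed.

Lemma masa_closed : norm_closed A M.
Proof.
  intros u l Hu Hl. apply lim_iff in Hl.
  destruct HM as [[_ [Hadd [Hsc [_ Hst]]]] [Hab _]].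
  destruct (re_im l) as [a [b [Ha [Hb [E Hc]]]]].
  assert (H : forall m, M m -> mul m l = mul l m /\ mul m (star l) = mul (star l) m).
  { intros m Hm. split; eapply lim_commute; [|exact Hl| |apply lim_star, Hl];
      intro n; apply Hab; auto. }
  rewrite E. apply Hadd, Hsc; apply masa_mem; try assumption;
    intros m Hm; destruct (H m Hm); now apply Hc.
Qed.

End Masa.
End Commutant.

(** * Annihilators have units *)

Section Annihilator.
Variable A : CStarAlgebra.
Implicit Types a b c p r x y z : A.

Definition annihilates (P : A -> Prop) x : Prop :=
  forall p, P p -> mul p x = zero /\ mul x p = zero.

Lemma sa_annihilates P x : (forall p, P p -> selfadj A p) -> selfadj A x ->
  (forall p, P p -> mul p x = zero) -> annihilates P x.
Proof.
  intros HP Hx H p Hp. split; [auto|]. specialize (HP p Hp).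
  rewrite <- (star_star A (mul x p)), star_mul, HP, Hx, (H p Hp). apply star_zero.
Qed.

Lemma le_of_pow_half (u v : R) : (forall n, u <= v + (/ 2) ^ n) -> u <= v.
Proof.
  intro H. apply Rnot_lt_le. intro Hlt.
  destruct (pow_lt_1_zero (/ 2)) with (y := u - v) as [N HN].
  - rewrite Rabs_pos_eq; lra.
  - lra.
  - specialize (HN N (le_n N)). specialize (H N).
    rewrite Rabs_pos_eq in HN by (apply pow_le; lra). lra.
Qed.

Variable P : A -> Prop.
Hypothesis HPsa : forall p, P p -> selfadj A p.
Hypothesis HPab : abelian A P.

(** * A maximal commuting set of selfadjoint elements of the annihilator *)

Section MaximalInAnnihilator.
Variable C : A -> Prop.
Hypothesis HC : forall x, C x -> selfadj A x /\ annihilates P x.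
Hypothesis HCab : abelian A C.
Hypothesis HCmax : forall x, selfadj A x -> annihilates P x ->
  (forall c, C c -> mul x c = mul c x) -> C x.

Lemma max_sa x : C x -> selfadj A x.
Proof. apply HC. Qed.

Lemma max_ann p x : C x -> P p -> mul p x = zero /\ mul x p = zero.
Proof. intros Hx Hp. now apply HC. Qed.

Lemma max_intro x : selfadj A x -> (forall p, P p -> mul p x = zero) ->
  (forall c, C c -> mul c x = mul x c) -> C x.
Proof.
  intros Hx Hp Hc. apply HCmax; [exact Hx|now apply sa_annihilates|].
  intros c H. symmetry. auto.
Qed.

Lemma max_zero : C zero.
Proof. apply max_intro; [apply star_zero|intros; alg|intros; alg]. Qed.

Lemma max_add x y : C x -> C y -> C (add x y).
Proof.
  intros Hx Hy. pose proof (max_sa x Hx). pose proof (max_sa y Hy).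
  apply max_intro; [sa| |].
  - intros p Hp. destruct (max_ann p x Hx Hp) as [E _]. destruct (max_ann p y Hy Hp) as [F _].
    rewrite mul_addr, E, F. alg.
  - intros c Hc. pose proof (HCab c x Hc Hx). pose proof (HCab c y Hc Hy). alg.
Qed.

Lemma max_rscal t x : C x -> C (rscal t x).
Proof.
  intros Hx. pose proof (max_sa x Hx).
  apply max_intro; [sa| |].
  - intros p Hp. destruct (max_ann p x Hx Hp) as [E _].
    rewrite mul_scalr, E. alg.
  - intros c Hc. pose proof (HCab c x Hc Hx). alg.
Qed.

Lemma max_sub x y : C x -> C y -> C (sub A x y).
Proof.
  intros Hx Hy. unfold sub. rewrite opp_scal. now apply max_add, max_rscal.
Qed.

Lemma max_mul x y : C x -> C y -> C (mul x y).
Proof.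
  intros Hx Hy. pose proof (max_sa x Hx). pose proof (max_sa y Hy).
  pose proof (HCab x y Hx Hy).
  apply max_intro; [sa| |].
  - intros p Hp. destruct (max_ann p x Hx Hp) as [E _].
    rewrite mul_assoc, E. alg.
  - intros c Hc. pose proof (HCab c x Hc Hx). pose proof (HCab c y Hc Hy). alg.
Qed.

Lemma max_lim u l : (forall n, C (u n)) -> lim u l -> C l.
Proof.
  intros Hu Hl. apply max_intro.
  - eapply lim_selfadj; [|exact Hl]. intro n. now apply max_sa.
  - intros p Hp. apply lim_unique with (fun n => mul p (u n)).
    + apply lim_mul; [apply lim_const|exact Hl].
    + apply lim_ext with (fun _ => zero); [|apply lim_const].
      intro n. symmetry. now apply (max_ann p).
  - intros c Hc. eapply lim_commute; [|exact Hl]. intro n. now apply HCab.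
Qed.

(* Double angle formula: with [a = sin w] and [1 - t = cos w], passing from [a] to
   [sin (2 w) = 2 a (1 - t)] gains a factor [1/2] at each step. *)
Lemma small_remainder n : forall a, C a -> norm a <= 1 ->
  exists r, C r /\ mbound 1 (opp r) 1 /\ norm (sub A a (mul r a)) <= (/ 2) ^ n.
Proof.
  induction n as [|n IH]; intros a Ha Hn.
  - exists zero. split; [apply max_zero|]. split.
    + intro y. replace (add (rscal 1 y) (mul (opp zero) y)) with y by alg. lra.
    + replace (sub A a (mul zero a)) with a by alg. simpl. lra.
  - pose proof (max_sa a Ha) as Hsa.
    destruct (cosine A a Hsa Hn) as [t [Ht [Htn [E [Hc [B1 [B2 _]]]]]]].
    assert (Hta : mul a t = mul t a) by (apply Hc; alg).
    assert (Ct : C t).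
    { apply max_intro; [exact Ht| |].
      - intros p Hp. destruct (max_ann p a Ha Hp) as [Epa _].
        (* From [2 t - t^2 = a^2] and [p a = 0]; as [norm t <= 1], this forces [p t = 0]. *)
        assert (E2 : rscal 2 (mul p t) = mul (mul p t) t).
        { transitivity (add (mul (mul p t) t) (mul (mul p a) a)).
          - alg_mod (fun z => mul p z) E.
          - rewrite Epa. alg. }
        pose proof (norm_mul A (mul p t) t) as H1. rewrite <- E2, norm_rscal in H1.
        rewrite Rabs_pos_eq in H1 by lra. apply norm_eq0.
        pose proof (norm_ge0 A (mul p t)). nra.
      - intros c Hcc. apply Hc. now apply HCab. }
    destruct (IH (rscal 2 (sub A a (mul t a)))) as [r [Hr [Br Nr]]].
    + now apply max_rscal, max_sub, max_mul.
    + apply norm_le_mbound in B2; [|lra]. rewrite Rabs_R0 in B2. lra.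
    (* This element is [1 - (1 - r)(1 - t)], so its remainder on [a] is half the remainder of [r] on
       [2 (1 - t) a]. *)
    + exists (sub A (add r t) (mul r t)). split; [|split].
      * apply max_sub; [now apply max_add|now apply max_mul].
      * eapply mbound_ext; [apply mbound_mul; [|apply Br|apply B1]; lra|ring|alg|lra].
      * replace (sub A a (mul (sub A (add r t) (mul r t)) a)) with
          (rscal (/ 2) (sub A (rscal 2 (sub A a (mul t a)))
             (mul r (rscal 2 (sub A a (mul t a)))))) by alg.
        rewrite norm_rscal, Rabs_pos_eq by lra. simpl. lra.
Qed.

(** The elements [1 - (1 - r)^2] with [1 - r] of multiplier norm at most 1. Products of such [1 - r]
    have the same form, which makes the family directed. *)
Definition unit_interval x : Prop :=
  exists r, C r /\ mbound 1 (opp r) 1 /\ x = sub A (rscal 2 r) (mul r r).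

Lemma unit_interval_max x : unit_interval x -> C x.
Proof. intros [r [Hr [_ ->]]]. now apply max_sub; [apply max_rscal|apply max_mul]. Qed.

Lemma unit_interval_mbound x : unit_interval x -> mbound 1 (opp x) 1.
Proof.
  intros [r [Hr [Br ->]]].
  eapply mbound_ext; [apply mbound_mul; [|apply Br|apply Br]; lra|ring|alg|lra].
Qed.

Lemma unit_interval_norm x : unit_interval x -> norm x <= 2.
Proof.
  intro Hx. apply unit_interval_mbound, norm_le_mbound in Hx; [|lra].
  rewrite norm_opp, Rabs_pos_eq in Hx; lra.
Qed.

Lemma unit_interval_zero : unit_interval zero.
Proof.
  exists zero. split; [apply max_zero|]. split; [|alg].
  intro y. replace (add (rscal 1 y) (mul (opp zero) y)) with y by alg. lra.
Qed.


(** Taking [1 - z = (1 - r)(1 - r')], the gap above [1 - (1 - r)^2] is [(1 - r)^2 v] with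
    [v = 1 - (1 - r')^2], the square of [(1 - r) g] for [g] the root of [v]. *)
Lemma unit_interval_directed x x' : unit_interval x -> unit_interval x' ->
  exists z, unit_interval z /\ cle A x z /\ cle A x' z.
Proof.
  assert (Hle : forall r r' z, C r -> C r' -> mbound 1 (opp r') 1 ->
    C z -> z = sub A (add r r') (mul r r') ->
    cle A (sub A (rscal 2 r) (mul r r)) (sub A (rscal 2 z) (mul z z))).
  { intros r r' z Hr Hr' Br' Hz Ez.
    set (v := sub A (rscal 2 r') (mul r' r')).
    assert (Hv : unit_interval v) by (exists r'; auto).
    pose proof (max_sa r Hr). pose proof (max_sa r' Hr'). pose proof (max_sa z Hz).
    pose proof (HCab r r' Hr Hr').
    destruct (pos_sqrt A v) as [g [[Hg _] [Eg Cg]]].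
    { split; [unfold v; sa|]. exists 1. split; [lra|]. now apply unit_interval_mbound. }
    assert (mul r g = mul g r) by (apply Cg; unfold v; alg).
    apply cle_of_sq with (sub A g (mul r g)); [sa|sa|sa|].
    rewrite Ez. unfold v in Eg.
    alg_mod (fun w => opp (sub A (sub A w (mul r w)) (mul r (sub A w (mul r w))))) Eg. }
  intros [r [Hr [Br ->]]] [r' [Hr' [Br' ->]]].
  set (z := sub A (add r r') (mul r r')).
  assert (Hz : C z) by (apply max_sub; [now apply max_add|now apply max_mul]).
  exists (sub A (rscal 2 z) (mul z z)). split; [|split].
  - exists z. split; [exact Hz|]. split; [|reflexivity].
    eapply mbound_ext; [apply mbound_mul; [|apply Br|apply Br']; lra|ring| |lra].
    unfold z. alg.
  - now apply Hle with r'.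
  - apply Hle with r; try assumption.
    pose proof (HCab r r' Hr Hr'). unfold z. alg.
Qed.

(** * From an upper bound of the family to a unit *)

Section UpperBound.
Variable s : A.
Hypothesis Hs : C s.
Hypothesis Hub : forall x, unit_interval x -> cle A x s.

(** Chosen so that [T - 1] bounds the norm of [s - x] for every [x] in the family, whose norms are
    at most 2. *)
Let T := norm s + 3.

(** Decompose [T - s = (T - 1 - g^2) + (1 - r)^2] with [g^2 = s - x]: the first term has multiplier
    norm at most [T - 1], and the second is arbitrarily small on [a]. *)
Lemma upper_bound_contraction_unit a : C a -> norm a <= 1 ->
  norm (sub A (rscal T a) (mul s a)) <= (T - 1) * norm a.
Proof.
  intros Ha Hn. pose proof (norm_ge0 A s) as Hs0.
  apply le_of_pow_half. intro n.
  destruct (small_remainder n a Ha Hn) as [r [Hr [Br Nr]]].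
  set (x := sub A (rscal 2 r) (mul r r)).
  assert (Hx : unit_interval x) by (exists r; auto).
  destruct (cle_sqrt A x s (Hub x Hx)) as [g [Hg [Eg _]]].
  assert (Bg : mbound (T - 1) (opp (mul g g)) (T - 1)).
  { apply sq_mbound; [exact Hg|unfold T; lra|]. rewrite <- Eg.
    pose proof (norm_sub_le A s x). pose proof (unit_interval_norm x Hx). unfold T. lra. }
  pose proof (Br (sub A a (mul r a))) as H. rewrite Rmult_1_l in H.
  eapply norm_le_add; [apply (Bg a)|eapply Rle_trans; [apply H|apply Nr]|].
  unfold x in Eg. alg_mod (fun w => opp (mul w a)) Eg.
Qed.

Lemma upper_bound_contraction a : C a ->
  norm (sub A (rscal T a) (mul s a)) <= (T - 1) * norm a.
Proof.
  (* Adding 1 keeps the scale invertible when [a] is zero. *)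
  intro Ha. set (k := norm a + 1). pose proof (norm_ge0 A a) as H0.
  assert (Hk : 0 < k) by (unfold k; lra).
  assert (Hik : 0 < / k) by now apply Rinv_0_lt_compat.
  assert (Hn : norm (rscal (/ k) a) = / k * norm a)
    by (rewrite norm_rscal, Rabs_pos_eq; lra).
  pose proof (upper_bound_contraction_unit (rscal (/ k) a)) as H.
  replace (sub A (rscal T (rscal (/ k) a)) (mul s (rscal (/ k) a)))
    with (rscal (/ k) (sub A (rscal T a) (mul s a))) in H by alg.
  rewrite Hn, norm_rscal, Rabs_pos_eq in H by lra.
  apply Rmult_le_reg_l with (/ k); [exact Hik|].
  rewrite <- Rmult_assoc, (Rmult_comm (/ k) (T - 1)), Rmult_assoc.
  apply H; [now apply max_rscal|].
  apply Rmult_le_reg_l with k; [exact Hk|].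
  rewrite <- Rmult_assoc, Rinv_r by lra. unfold k. lra.
Qed.

(* The affine map [e => e + (1 - e) s / T] contracts, and its fixed point is a unit. *)
Lemma max_unit : exists e, C e /\ forall a, C a -> mul e a = a.
Proof.
  assert (HT : 0 < T) by (pose proof (norm_ge0 A s); unfold T; lra).
  assert (HiT : 0 < / T) by now apply Rinv_0_lt_compat.
  set (f e := add e (rscal (/ T) (sub A s (mul e s)))).
  set (u n := Nat.iter n f zero).
  assert (Cu : forall n, C (u n)).
  { induction n as [|n IH]; [apply max_zero|].
    change (C (f (u n))). unfold f.
    apply max_add; [exact IH|]. apply max_rscal, max_sub; [exact Hs|]. now apply max_mul. }
  set (rho := (T - 1) / T).
  assert (Hrho : 0 <= rho).
  { unfold rho. apply Rmult_le_pos; [|lra]. pose proof (norm_ge0 A s). unfold T. lra. }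
  assert (Hstep : forall n, norm (sub A (u (S n)) (u n)) <= rho ^ n * (/ T * norm s)).
  { induction n as [|n IH].
    - change (u 1%nat) with (f zero). change (u 0%nat) with (zero : A).
      replace (sub A (f zero) zero) with (rscal (/ T) s) by (unfold f; alg).
      rewrite norm_rscal, Rabs_pos_eq by lra. simpl. lra.
    - set (d := sub A (u (S n)) (u n)).
      assert (Cd : C d) by now apply max_sub.
      replace (sub A (u (S (S n))) (u (S n)))
        with (rscal (/ T) (sub A (rscal T d) (mul s d))).
      + rewrite norm_rscal, Rabs_pos_eq by lra.
        pose proof (upper_bound_contraction d Cd).
        apply Rle_trans with (rho * norm d).
        * unfold rho, Rdiv. rewrite (Rmult_comm (T - 1)), Rmult_assoc.
          apply Rmult_le_compat_l; lra.
        * simpl. rewrite Rmult_assoc. apply Rmult_le_compat_l; [exact Hrho|exact IH].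
      + change (u (S (S n))) with (f (u (S n))).
        transitivity (sub A (f (u (S n))) (f (u n))); [|reflexivity].
        pose proof (HCab s (u n) Hs (Cu n)). pose proof (HCab s (u (S n)) Hs (Cu (S n))).
        unfold d, f. set (v := u (S n)) in *. set (w := u n) in *. alg. }
  (* As [1 - rho = / T], the bound of [Hstep] telescopes. *)
  destruct (lim_of_variation A u (fun n => - (rho ^ n * norm s)) 0) as [e He].
  - intro n. eapply Rle_trans; [apply Hstep|]. right. unfold rho. simpl. field. lra.
  - intro n. pose proof (pow_le rho n Hrho). pose proof (norm_ge0 A s). nra.
  - exists e. assert (Ce : C e) by now apply max_lim with u.
    split; [exact Ce|].
    assert (Ef : e = f e).
    { apply lim_unique with (fun n => u (S n)); [now apply lim_shift|].
      apply lim_add; [exact He|]. apply lim_rscal, lim_sub; [apply lim_const|].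
      apply lim_mul; [exact He|apply lim_const]. }
    unfold f in Ef.
    assert (Es : mul e s = s).
    { alg_mod (fun w : A => rscal T w) Ef. }
    (* Here [s y = 0] because [e s = s], so the contraction reads
       [T * norm y <= (T - 1) * norm y]. *)
    intros a Ha. set (y := sub A a (mul e a)).
    assert (Cy : C y) by now apply max_sub; [|apply max_mul].
    pose proof (upper_bound_contraction y Cy) as H.
    pose proof (HCab e s Ce Hs).
    replace (sub A (rscal T y) (mul s y)) with (rscal T y) in H.
    + rewrite norm_rscal, Rabs_pos_eq in H by lra.
      symmetry. apply sub_eq0, norm_eq0. fold y. pose proof (norm_ge0 A y). nra.
    + unfold y. alg_mod (fun w => opp (mul w a)) Es.
Qed.

End UpperBound.

Lemma unit_of_max_unit e x : C e -> (forall a, C a -> mul e a = a) ->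
  annihilates P x -> mul e x = x.
Proof.
  intros Ce He Hx. pose proof (max_sa e Ce) as Hse.
  set (y := sub A x (mul e x)). set (z := mul y (star y)).
  assert (Hey : mul e y = zero).
  { unfold y. alg_mod (fun w => opp (mul w x)) (He e Ce). }
  assert (Hcy : forall c, C c -> mul c y = zero).
  { intros c Hc. pose proof (HCab c e Hc Ce).
    unfold y. alg_mod (fun w => opp (mul w x)) (He c Hc). }
  assert (Cz : C z).
  { apply max_intro; [unfold z; sa| |].
    - intros p Hp. destruct (Hx p Hp) as [Epx _]. destruct (max_ann p e Ce Hp) as [Epe _].
      unfold z, y.
      transitivity (mul (sub A (mul p x) (mul (mul p e) x)) (star (sub A x (mul e x)))); [alg|].
      rewrite Epx, Epe. alg.
    - intros c Hc. transitivity (zero : A).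
      + unfold z. rewrite mul_assoc, (Hcy c Hc). alg.
      + pose proof (f_equal star (Hcy c Hc)) as H. rewrite star_mul, star_zero in H.
        rewrite (max_sa c Hc) in H. unfold z. rewrite <- mul_assoc, H. alg. }
  assert (Ez : z = zero).
  { rewrite <- (He z Cz). unfold z. rewrite mul_assoc, Hey. alg. }
  symmetry. apply sub_eq0. fold y.
  rewrite <- (star_star A y). rewrite (star_mul_eq0 A (star y)); [apply star_zero|].
  now rewrite star_star.
Qed.

End MaximalInAnnihilator.

Hypothesis Hmc : forall M : A -> Prop, masa A M -> monotone_complete_sub A M.

Theorem annihilator_unit : exists u, is_proj A u /\ annihilates P u /\
  forall x, annihilates P x -> mul u x = x /\ mul x u = x.
Proof.
  destruct (maximal_commuting A (fun x => selfadj A x /\ annihilates P x) (fun _ => False))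
    as [C [_ [HC [HCab Hmax]]]]; [easy|easy|].
  assert (HCmax : forall x, selfadj A x -> annihilates P x ->
    (forall c, C c -> mul x c = mul c x) -> C x) by auto.
  clear Hmax.
  destruct (masa_containing A (fun x => C x \/ P x)) as [M [HM HCPM]].
  { intros x [Hx|Hx]; [now apply HC|auto]. }
  { intros x y [Hx|Hx] [Hy|Hy]; auto.
    - destruct (max_ann C HC y x Hx Hy) as [-> ->]. reflexivity.
    - destruct (max_ann C HC x y Hy Hx) as [-> ->]. reflexivity. }
  assert (HMab : abelian A M) by apply HM.
  destruct (Hmc M HM (unit_interval C)) as [s [Ms [Hs [Hub Hleast]]]].
  - intros x Hx. apply unit_interval_max in Hx; try assumption.
    split; [auto|now apply HC].
  - exists zero. now apply unit_interval_zero.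
  - now apply unit_interval_directed.
  - exists 2. now apply unit_interval_norm.
  (* The supremum is only known to lie in [M]. Its leastness is used to show that it annihilates
     [P], which places it in [C]. *)
  - assert (Cs : C s).
    { apply max_intro; try assumption; [|intros c Hc; apply HMab; auto].
      intros p Hp. set (q := rscal (/ (norm p + 1)) p).
      pose proof (norm_ge0 A p) as Hp0.
      assert (Hk : 0 < / (norm p + 1)) by (apply Rinv_0_lt_compat; lra).
      pose proof (HPsa p Hp) as Hsp.
      assert (Hsq : selfadj A q) by (unfold q; sa).
      assert (Hps : mul p s = mul s p) by (apply HMab; auto).
      assert (Hqs : mul q s = mul s q) by (unfold q; alg).
      assert (Hqn : norm q <= 1).
      { unfold q. rewrite norm_rscal, Rabs_pos_eq by lra.
        apply Rmult_le_reg_l with (norm p + 1); [lra|].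
        rewrite <- Rmult_assoc, Rinv_r by lra. lra. }
      (* Since [(1 - t)^2 = 1 - q^2], multiplying a square [g^2] by [1 - q^2] gives the square of
         [(1 - t) g]. *)
      destruct (cosine A q Hsq Hqn) as [t [Ht [_ [Et [Hct _]]]]].
      set (w := sub A s (mul (mul s q) q)).
      assert (Hsw : selfadj A w) by (unfold w; sa).
      assert (Mw : M w).
      { apply masa_mem; try assumption. intros m Hm.
        assert (mul m p = mul p m) by (apply HMab; auto).
        assert (mul m s = mul s m) by (apply HMab; auto).
        unfold w, q. alg. }
      (* Since [x q = 0], multiplying [x <= s] by [1 - q^2] gives [x <= s (1 - q^2)]. *)
      assert (Hsup : cle A s w).
      { apply Hleast; [exact Mw|exact Hsw|]. intros x Hx.
        destruct (cle_sqrt A x s (Hub x Hx)) as [g [Hg [Eg Hcg]]].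
        pose proof (unit_interval_max C HC HCab HCmax x Hx) as Cx.
        destruct (max_ann C HC p x Cx Hp) as [Epx Exp].
        assert (Hqx : mul q x = mul x q).
        { unfold q. transitivity (rscal (/ (norm p + 1)) (mul p x)); [alg|].
          rewrite Epx, <- Exp. alg. }
        assert (Hqg : mul q g = mul g q) by (apply Hcg; alg).
        assert (Htg : mul t g = mul g t) by (symmetry; apply Hct; now symmetry).
        assert (Hqt : mul q t = mul t q) by (now apply Hct).
        assert (Hxs : selfadj A x) by (apply HC, Cx).
        apply cle_of_sq with (sub A g (mul t g)); [exact Hxs|exact Hsw|sa|].
        transitivity (sub A (mul g g) (mul (mul q q) (mul g g))).
        - rewrite <- Eg. unfold w.
          assert (Eqx : mul q x = zero)
            by (unfold q; transitivity (rscal (/ (norm p + 1)) (mul p x));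
                [alg|rewrite Epx; alg]).
          alg_mod (fun v : A => opp (mul q v)) Eqx.
        - rewrite <- Et. alg. }
      destruct (cle_sqrt A _ _ (Hub zero (unit_interval_zero C HCmax)))
        as [g [Hg [Eg Hcg]]].
      assert (Hqg : mul q g = mul g q) by (apply Hcg; alg).
      (* As zero is in the family, [s = g^2]; then [s <= s - s q^2] makes both [(g q)^2] and its
         opposite positive. *)
      assert (Egq : mul g q = zero).
      { apply sq_eq0; [sa|].
        assert (Ew : mul (mul g q) (mul g q) = sub A s w).
        { unfold w. transitivity (mul (mul g g) (mul q q)); [alg|]. rewrite <- Eg. alg. }
        apply pos_antisym; [apply pos_sq; sa|].
        rewrite Ew. apply cle_pos in Hsup.
        replace (opp (sub A s w)) with (sub A w s) by alg. exact Hsup. }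
      assert (Eqs : mul q s = zero).
      { transitivity (mul g (mul g q)); [|rewrite Egq; alg].
        transitivity (mul q (mul g g)); [rewrite <- Eg|]; alg. }
      transitivity (rscal (norm p + 1) (mul q s)); [unfold q|rewrite Eqs]; alg. }
    destruct (max_unit C HC HCab HCmax s Cs Hub) as [e [Ce He]].
    assert (Hl : forall x, annihilates P x -> mul e x = x)
      by (intros x Hx; now apply (unit_of_max_unit C)).
    exists e. split; [split; [now apply He|now apply HC]|].
    split; [now apply HC|]. intros x Hx. split; [now apply Hl|].
    assert (Hxs : annihilates P (star x)).
    { intros p Hp. destruct (Hx p Hp) as [E1 E2].
      split; rewrite <- (HPsa p Hp), <- star_mul, ?E1, ?E2; apply star_zero. }
    apply Hl in Hxs. apply (f_equal star) in Hxs.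
    rewrite star_mul, star_star in Hxs.
    now rewrite (proj1 (HC e Ce)) in Hxs.
Qed.

End Annihilator.

(** * Projections *)

Section Projections.
Variable A : CStarAlgebra.
Implicit Types p q u x y z : A.

(** The difference [q - p] is itself a projection, hence its own square. *)
Lemma cle_proj p q : is_proj A p -> is_proj A q -> mul p q = p -> cle A p q.
Proof.
  intros [Epp Hp] [Eqq Hq] E.
  assert (E' : mul q p = p) by (apply (f_equal star) in E; now rewrite star_mul, Hp, Hq in E).
  apply cle_of_sq with (sub A q p); [exact Hp|exact Hq|sa|].
  transitivity (add (sub A (mul q q) (mul p q)) (sub A (mul p p) (mul q p))); [|alg].
  rewrite Eqq, E, E', Epp. alg.
Qed.

(* Compressing [q - p >= 0] by [1 - q] gives [- y^* y >= 0] for [y = p (1 - q)]. *)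
Lemma proj_cle p q : is_proj A p -> is_proj A q -> cle A p q -> mul p q = p.
Proof.
  intros [Epp Hp] [Eqq Hq] [_ [_ [b Eb]]].
  set (y := sub A p (mul p q)). set (z := sub A b (mul b q)).
  assert (E : mul (star y) y = opp (mul (star z) z)).
  { transitivity (sub A (sub A p (mul p q)) (mul q (sub A p (mul p q)))).
    { unfold y. star_norm. transitivity (sub A (sub A (mul p p) (mul (mul p p) q))
        (mul q (sub A (mul p p) (mul (mul p p) q)))); [alg|]. now rewrite Epp. }
    transitivity (opp (sub A (sub A (mul (star b) b) (mul (mul (star b) b) q))
      (mul q (sub A (mul (star b) b) (mul (mul (star b) b) q)))));
      [rewrite <- Eb|unfold z; star_norm; alg].
    alg_mod (fun w => opp (sub A w (mul q w))) Eqq. }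
  assert (Ey : y = zero).
  { apply star_mul_eq0, pos_antisym; [apply pos_star_mul|]. rewrite E.
    replace (opp (opp (mul (star z) z))) with (mul (star z) z) by alg. apply pos_star_mul. }
  symmetry. now apply sub_eq0.
Qed.

Hypothesis Hmc : forall M : A -> Prop, masa A M -> monotone_complete_sub A M.

Variable e : A.
Hypothesis He : forall x, mul e x = x /\ mul x e = x.
Hypothesis Hse : selfadj A e.

(** The norm of [e] equals its own square; the value 0 occurs when the algebra is zero. *)
Lemma norm_unit_le1 : norm e <= 1.
Proof.
  pose proof (norm_sq A e Hse) as H. rewrite (proj1 (He e)) in H.
  pose proof (norm_ge0 A e). nra.
Qed.

(* The unit [u] of the annihilator of [|x| - x] is the projection onto [x >= 0], and the
   symmetry [w = 2 u - 1] satisfies [2 x - w = w (2 |x| - 1)]. *)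
Lemma sign_projection (M : A -> Prop) x : masa A M -> M x -> selfadj A x -> norm x <= 1 ->
  exists u, M u /\ is_proj A u /\
    norm (sub A (rscal 2 x) (sub A (rscal 2 u) e)) <= 1.
Proof.
  intros HM Mx Hx Hn.
  destruct (pos_sqrt A _ (pos_sq A x Hx)) as [h [Hh [Eh Ch]]].
  destruct (pos_sqrt A _ Hh) as [g [[Hg _] [Eg _]]].
  assert (Hsh : selfadj A h) by apply Hh.
  assert (Hxh : mul x h = mul h x) by (apply Ch; alg).
  set (n := sub A h x).
  assert (Hsn : selfadj A n) by (unfold n; sa).
  destruct (annihilator_unit A (fun y => y = n)) as [u [[Euu Hu] [Hun Hunit]]].
  { now intros p ->. }
  { now intros p q -> ->. }
  { exact Hmc. }
  destruct (Hun n eq_refl) as [Enu _].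
  assert (Hann : forall y, mul n y = zero -> mul y n = zero -> mul u y = y /\ mul y u = y).
  { intros y H1 H2. apply Hunit. now intros p ->. }
  assert (Mu : M u).
  { apply masa_mem; [exact HM|exact Hu|]. intros m Hm.
    assert (Hmx : mul m x = mul x m) by (apply (proj1 (proj2 HM)); assumption).
    assert (Hmh : mul m h = mul h m) by (apply Ch; alg).
    assert (Hmn : mul m n = mul n m) by (unfold n; alg).
    destruct (Hun n eq_refl) as [_ Eun].
    (* Both [m u] and [u m] annihilate [n], so [u] is a unit for them and [m u = u m u = u m]. *)
    assert (E1 : mul u (mul m u) = mul m u).
    { apply Hann.
      - transitivity (mul m (mul n u)); [alg|]. rewrite Enu. alg.
      - transitivity (mul m (mul u n)); [alg|]. rewrite Eun. alg. }
    assert (E2 : mul (mul u m) u = mul u m).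
    { apply Hann.
      - transitivity (mul (mul n u) m); [alg|]. rewrite Enu. alg.
      - transitivity (mul (mul u n) m); [alg|]. rewrite Eun. alg. }
    rewrite <- E1, <- E2. alg. }
  exists u. split; [exact Mu|]. split; [now split|].
  assert (Hux : mul u x = mul x u) by (apply (proj1 (proj2 HM)); assumption).
  assert (Huh : mul u h = mul h u) by (apply Ch; alg).
  assert (Eup : mul u (add h x) = add h x).
  { apply Hann; unfold n; alg_mod (fun w : A => w) Eh. }
  assert (Hhx : mul u h = mul u x).
  { unfold n in Enu. alg_mod (fun w : A => w) Enu. }
  set (w := sub A (rscal 2 u) e).
  assert (Hsw : selfadj A w) by (unfold w; sa).
  assert (Eww : mul w w = e).
  { unfold w. transitivity (sub A (rscal 4 (mul u u))
      (sub A (rscal 2 (add (mul u e) (mul e u))) (mul e e))); [alg|].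
    rewrite Euu, !(proj1 (He _)), (proj2 (He _)). alg. }
  assert (Ewx : mul w x = h).
  { unfold w. transitivity (sub A (rscal 2 (mul u x)) (mul e x)); [alg|].
    rewrite (proj1 (He x)).
    transitivity (sub A (mul u (add h x)) x); [alg_mod (fun w : A => opp w) Hhx|].
    rewrite Eup. alg. }
  assert (Hwn : norm w <= 1).
  { pose proof (norm_sq A w Hsw) as H. rewrite Eww in H.
    pose proof norm_unit_le1. pose proof (norm_ge0 A w). nra. }
  assert (Hgn : norm g <= 1).
  { pose proof (norm_sq A g Hg) as H1. rewrite Eg in H1.
    pose proof (norm_sq A h Hsh) as H2. rewrite Eh, (norm_sq A x Hx) in H2.
    pose proof (norm_ge0 A g). pose proof (norm_ge0 A h). pose proof (norm_ge0 A x).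
    assert (norm h <= 1) by nra. nra. }
  destruct (cosine A g Hg Hgn) as [_ [_ [_ [_ [_ [_ [_ B]]]]]]].
  (* Tested on [e], the bound on [1 - 2 g^2] controls the norm of [e - 2 h], where [h] is the
     absolute value of [x]. *)
  specialize (B e). rewrite Eg in B.
  replace (sub A (rscal 2 x) w)
    with (opp (mul w (add (rscal 1 e) (mul (rscal (-2) h) e)))).
  - rewrite norm_opp. eapply Rle_trans; [apply norm_mul|].
    pose proof norm_unit_le1. pose proof (norm_ge0 A w).
    pose proof (norm_ge0 A (add (rscal 1 e) (mul (rscal (-2) h) e))). nra.
  - rewrite (proj2 (He _)).
    transitivity (sub A (rscal 2 (mul w h)) (mul w e)); [alg|].
    rewrite (proj2 (He w)). f_equal. rewrite <- Ewx.
    transitivity (rscal 2 (mul (mul w w) x)); [alg|].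
    now rewrite Eww, (proj1 (He x)).
Qed.

Lemma masa_unit M : masa A M -> M e.
Proof.
  intro HM. apply masa_mem; [exact HM|exact Hse|]. intros m _.
  destruct (He m) as [E1 E2]. now rewrite E1.
Qed.

(** Bisection: [2 x - (2 u - e)] again meets the hypotheses on [x], and an approximation [z] of it
    yields [(z + 2 u - e) / 2] for [x] with half the error. *)
Lemma dyadic_approx (M N : A -> Prop) n : masa A M -> sa_subalg A N ->
  (forall p, M p -> is_proj A p -> N p) ->
  forall x, M x -> selfadj A x -> norm x <= 1 ->
  exists z, N z /\ norm (sub A z x) <= (/ 2) ^ n.
Proof.
  intros HM HN HMN.
  pose proof (masa_unit M HM) as Me.
  assert (Ne : N e) by (apply HMN; [exact Me|split; [apply He|exact Hse]]).
  destruct HN as [N0 [Nadd [Nsc _]]].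
  destruct (proj1 HM) as [_ [Madd [Msc _]]].
  induction n as [|n IH]; intros x Mx Hx Hn.
  - exists zero. split; [exact N0|]. rewrite norm_sub_sym.
    replace (sub A x zero) with x by alg. simpl. lra.
  - destruct (sign_projection M x HM Mx Hx Hn) as [u [Mu [Hu Hd]]].
    assert (Hsu : selfadj A u) by apply Hu.
    destruct (IH (sub A (rscal 2 x) (sub A (rscal 2 u) e))) as [z [Nz Hz]].
    + replace (sub A (rscal 2 x) (sub A (rscal 2 u) e))
        with (add (rscal 2 x) (add (rscal (-2) u) e)) by alg. auto.
    + sa.
    + exact Hd.
    + exists (rscal (/ 2) (add z (add (rscal 2 u) (rscal (-1) e)))). split; [auto 10|].
      match goal with |- norm ?y <= _ =>
        replace y with (rscal (/ 2) (sub A z (sub A (rscal 2 x) (sub A (rscal 2 u) e))))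
          by alg end.
      rewrite norm_rscal, Rabs_pos_eq by lra. simpl. lra.
Qed.

Lemma masa_proj_generated M : masa A M -> proj_generated A M.
Proof.
  intros HM x. split.
  - intros Mx N HN Ncl HMN.
    destruct (proj1 HM) as [_ [Madd [Msc _]]].
    assert (Hsa : forall y, M y -> selfadj A y -> N y).
    { intros y My Hy. set (k := norm y + 1). pose proof (norm_ge0 A y) as H0.
      assert (Hik : 0 < / k) by (apply Rinv_0_lt_compat; unfold k; lra).
      replace y with (rscal k (rscal (/ k) y)).
      2:{ transitivity (rscal (k * / k) y); [alg|]. rewrite Rinv_r by (unfold k; lra). alg. }
      apply HN.
      assert (Hn : norm (rscal (/ k) y) <= 1).
      { rewrite norm_rscal, Rabs_pos_eq by lra.
        apply Rmult_le_reg_l with k; [unfold k; lra|].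
        rewrite <- Rmult_assoc, Rinv_r by (unfold k; lra). unfold k. lra. }
      assert (Hsy : selfadj A (rscal (/ k) y)) by sa.
      set (v := rscal (/ k) y) in *.
      assert (Hz : forall n : nat, exists z, N z /\ norm (sub A z v) <= (/ 2) ^ n).
      { intro n. apply dyadic_approx with M; auto. now apply Msc. }
      set (f n := proj1_sig (constructive_indefinite_description _ (Hz n))).
      assert (Hf : forall n, N (f n) /\ norm (sub A (f n) v) <= (/ 2) ^ n)
        by (intro n; unfold f; apply proj2_sig).
      apply Ncl with f; [intro n; apply Hf|].
      apply lim_iff. apply lim_squeeze with (fun n => (/ 2) ^ n); [intro n; apply Hf|].
      intros eps Heps. destruct (pow_lt_1_zero (/ 2)) with (y := eps) as [K HK].
      - rewrite Rabs_pos_eq; lra.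
      - exact Heps.
      - exists K. intros n Hn'. unfold Rdist. rewrite Rminus_0_r. now apply HK. }
    destruct (re_im A x) as [a [b [Ha [Hb [E Hc]]]]].
    assert (HMcomm : forall m, M m -> mul m x = mul x m /\ mul m (star x) = mul (star x) m).
    { intros m Hm. destruct HM as [[_ [_ [_ [_ Mst]]]] [Hab _]]. split; apply Hab; auto. }
    destruct HN as [_ [Nadd [Nsc _]]].
    rewrite E. apply Nadd; [|apply Nsc]; apply Hsa; try assumption;
      (apply masa_mem; [exact HM|assumption|]); intros m Hm;
      destruct (HMcomm m Hm); now apply Hc.
  - intro H. apply H; [apply HM|now apply masa_closed|auto].
Qed.

Lemma orthogonal_lub (I : Type) (p : I -> A) :
  (forall i, is_proj A (p i)) ->
  (forall i j, i <> j -> mul (p i) (p j) = zero) ->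
  exists q, is_proj A q /\ (forall i, cle A (p i) q) /\
    (forall f, is_proj A f -> (forall i, cle A (p i) f) -> cle A q f).
Proof.
  intros Hp Horth.
  destruct (annihilator_unit A (fun x => exists i, x = p i)) as [u [Hu [Hun Hunit]]].
  { intros x [i ->]. apply Hp. }
  { intros x y [i ->] [j ->]. destruct (classic (i = j)) as [->|Hij]; [reflexivity|].
    rewrite !Horth; auto. }
  { exact Hmc. }
  assert (Hcompl : forall f, is_proj A f -> is_proj A (sub A e f)).
  { intros f [Eff Hf]. split; [|sa].
    transitivity (sub A (sub A (mul e e) (mul e f)) (sub A (mul f e) (mul f f))); [alg|].
    rewrite Eff, !(proj1 (He _)), (proj2 (He f)). alg. }
  exists (sub A e u). split; [auto|]. split.
  - intro i. apply cle_proj; auto.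
    transitivity (sub A (mul (p i) e) (mul (p i) u)); [alg|].
    rewrite (proj1 (Hun (p i) (ex_intro _ i eq_refl))), (proj2 (He _)). alg.
  (* For an upper bound [f], the complement [e - f] annihilates every [p i], so [u (e - f) = e - f],
     which rearranges to [(e - u) f = e - u]. *)
  - intros f Hf Hle. apply cle_proj; auto.
    assert (Hf' : annihilates A (fun x => exists i, x = p i) (sub A e f)).
    { apply sa_annihilates.
      - intros x [i ->]. apply Hp.
      - now apply Hcompl.
      - intros x [i ->].
        transitivity (sub A (mul (p i) e) (mul (p i) f)); [alg|].
        rewrite (proj2 (He _)), (proj_cle (p i) f) by auto. alg. }
    destruct (Hunit _ Hf') as [E _].
    assert (E' : sub A u (mul u f) = sub A e f).
    { rewrite <- E. transitivity (sub A (mul u e) (mul u f)); [|alg].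
      now rewrite (proj2 (He u)). }
    transitivity (sub A (mul e f) (mul u f)); [alg|]. rewrite (proj1 (He f)).
    alg_mod (fun w : A => w) E'.
Qed.

End Projections.

Theorem theorem1p5 (A : CStarAlgebra) :
  (forall M : A -> Prop, masa A M -> monotone_complete_sub A M) ->
  has_unit A /\ AWstar A.
Proof.
  intro Hmc.
  destruct (annihilator_unit A (fun _ => False)) as [e [[_ Hse] [_ Hunit]]]; try easy.
  assert (He : forall x : A, mul e x = x /\ mul x e = x) by (intro x; now apply Hunit).
  split; [now exists e|]. split.
  - intros M HM. now apply masa_proj_generated with e.
  - intros I p. now apply orthogonal_lub with e.
Qed.
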